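(* Let $\varphi(z)=1+B_1z+B_2z^2+B_3z^3+\cdots$ be an analytic function with positive real part in $\mathbb{D}$ such that $\varphi(0)=1$, $B_1=\varphi'(0)>0$, and $\varphi(\mathbb{D})$ is symmetric about the real axis and starlike with respect to $1$, and suppose $\varphi''(0)\in\mathbb{R}$. Let $f(z)=z+\sum_{n=2}^\infty a_nz^n$ belong to $\mathcal{S}^*_\sigma(\varphi)$. (a) If $B_2\leq B_1^2$, then \[ |a_2|\leq \frac{B_1\sqrt{B_1}}{\sqrt{B_1^2+B_1-B_2}} \quad \text{and}\quad |a_3|\leq \max\left\{ \frac{B_1^3}{B_1^2-B_2+B_1},\, \frac{B_1}{2} \right\}. \] (b) If $B_2\geq B_1^2$, then \[ |a_2|\leq\frac{B_1\sqrt{B_1}}{\sqrt{B_2+B_1-B_1^2}}\quad \text{and} \quad |a_3|\leq \max\left\{ \frac{B_1^3}{B_2+B_1-B_1^2},\, \frac{B_1}{2} \right\}. \]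
   Context: $\mathbb{D}:=\{z\in\mathbb{C}:|z|<1\}$. $\mathcal{A}$ is the class of analytic functions on $\mathbb{D}$ of the form $f(z)=z+\sum_{n=2}^\infty a_nz^n$. A function $f\in\mathcal{A}$ is bi-univalent if $f$ is univalent (injective) in $\mathbb{D}$ and its inverse $f^{-1}$ (which, by the Koebe one-quarter theorem, is defined in a disk around $0$ of radius at least $1/4$) has an analytic extension $g$ to $\mathbb{D}$ that is univalent in $\mathbb{D}$. The class of bi-univalent functions is denoted $\sigma$. For analytic functions $F,G$ on $\mathbb{D}$, $F$ is subordinate to $G$, written $F(z)\prec G(z)$, if there is a Schwarz function $w$ (analytic $w:\mathbb{D}\to\mathbb{D}$ with $w(0)=0$) such that $F=G\circ w$. For $\varphi$ as in the claim, a function $f\in\sigma$ is in the class $\mathcal{S}^*_\sigma(\varphi)$ of Ma-Minda bi-starlike functions if \[ \frac{zf'(z)}{f(z)}\prec \varphi(z) \quad\text{and}\quad \frac{wg'(w)}{g(w)}\prec\varphi(w), \] where $g$ denotes the univalent extension of $f^{-1}$ to $\mathbb{D}$ (the quotients being given their value $1$ at the origin). *)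

(* Defs.v *)
From Stdlib Require Import Reals.
From Coquelicot Require Import Coquelicot.

Open Scope R_scope.

Definition in_disk (z : C) : Prop := Cmod z < 1.

(* Functions on the disk are total functions C -> C whose values outside the
   disk are irrelevant: the radius r below can always be shrunk. *)
Definition analytic_in_disk (f : C -> C) : Prop :=
  forall z0 : C, in_disk z0 ->
    exists (c : nat -> C) (r : R), 0 < r /\
      forall z : C, Cmod (z - z0)%C < r ->
        is_pseries (K := C_AbsRing) (V := C_NormedModule) c (z - z0)%C (f z).

Definition has_expansion (f : C -> C) (a : nat -> C) : Prop :=
  forall z : C, in_disk z ->
    is_pseries (K := C_AbsRing) (V := C_NormedModule) a z (f z).

Definition normalized_expansion (f : C -> C) (a : nat -> C) : Prop :=
  a 0%nat = RtoC 0 /\ a 1%nat = RtoC 1 /\ has_expansion f a.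

Definition class_A (f : C -> C) : Prop :=
  analytic_in_disk f /\ exists a : nat -> C, normalized_expansion f a.

Definition univalent (f : C -> C) : Prop :=
  analytic_in_disk f /\
  forall z1 z2 : C, in_disk z1 -> in_disk z2 -> f z1 = f z2 -> z1 = z2.

(* For f univalent in class A, Koebe's one-quarter theorem says that the image
   of the disk contains {|w| < 1/4}; the last clause thus says that g coincides
   with the inverse of f on {|w| < 1/4}. *)
Definition univalent_inverse_extension (f g : C -> C) : Prop :=
  univalent g /\
  forall z : C, in_disk z -> Cmod (f z) < 1 / 4 -> g (f z) = z.

Definition bi_univalent (f : C -> C) : Prop :=
  class_A f /\ univalent f /\
  exists g : C -> C, univalent_inverse_extension f g.

Definition schwarz_function (w : C -> C) : Prop :=
  analytic_in_disk w /\ w (RtoC 0) = RtoC 0 /\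
  forall z : C, in_disk z -> in_disk (w z).

Definition subordinate (F G : C -> C) : Prop :=
  exists w : C -> C, schwarz_function w /\
    forall z : C, in_disk z -> F z = G (w z).

Definition starlike_quotient (f : C -> C) (z : C) : C :=
  if Ceq_dec z (RtoC 0) then RtoC 1 else (z * C_derive f z / f z)%C.

(* The extension g is unique, by the identity theorem. *)
Definition bi_starlike (phi f : C -> C) : Prop :=
  bi_univalent f /\
  exists g : C -> C, univalent_inverse_extension f g /\
    subordinate (starlike_quotient f) phi /\
    subordinate (starlike_quotient g) phi.

Definition disk_image (phi : C -> C) (u : C) : Prop :=
  exists z : C, in_disk z /\ phi z = u.

Definition symmetric_about_real_axis (S : C -> Prop) : Prop :=
  forall u : C, S u -> S (Cconj u).

Definition starlike_wrt (c : C) (S : C -> Prop) : Prop :=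
  S c /\
  forall (u : C) (t : R), S u -> 0 <= t <= 1 ->
    S (RtoC (1 - t) * c + RtoC t * u)%C.

(* Main.v *)
Require Import Defs.
From Stdlib Require Import Reals Lra Lia Classical ClassicalEpsilon.
From Coquelicot Require Import Coquelicot.

Open Scope R_scope.

(** Write [f(z) = z + a2 z^2 + a3 z^3 + ...], so that its inverse is
    [g(w) = w - a2 w^2 + (2 a2^2 - a3) w^3 + ...].  If [z f' = f (phi o u)] and
    [w g' = g (phi o v)] with Schwarz functions [u = u1 z + u2 z^2 + ...] and
    [v = v1 w + v2 w^2 + ...], comparing coefficients gives
    [a2 = B1 u1 = - B1 v1] and
      [2 a3   = a2^2 (1 + B2 / B1^2) + B1 u2],
      [2 a3   = a2^2 (3 - B2 / B1^2) - B1 v2].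
    The only function-theoretic inequality is [|u2| <= 1 - |u1|^2] (and the same
    for [v]), that is [|u2|, |v2| <= 1 - |a2|^2 / B1^2].

    Put [D = |B1^2 - B2|].  Subtracting the two equations bounds
    [D |a2|^2] by [B1 (B1^2 - |a2|^2)], which is the estimate of [a2].  For [a3],
    the smaller of the two coefficients of [a2^2] is [2 - D / B1^2].  When it is
    nonnegative, the equation in which it occurs bounds [|a3|] by an affine
    function of [|a2|^2], whose values at the two ends of the range of [|a2|^2]
    are [B1 / 2] and [B1^3 / (D + B1)].  When it is negative, the other
    coefficient is positive, and the convex combination of the two equations
    that kills [a2^2] gives [|a3| <= B1 / 2]
    ([coefficient_bounds], [bounds_of_linear_bounds]).

    All function theory is done with second-order expansions
    [f(z + h) = c0 + c1 h + c2 h^2 + O(h^3)], called jets.  They are stable under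
    the algebraic operations and composition, so the comparison of coefficients
    is the uniqueness of jets ([starlike_coefficients], [inverse_coefficients]),
    and they are all that the maximum principle needs.  Indeed the values of
    [c0 + c1 h + c2 h^2] at [h = t, i t, -t, -i t] have mean square at least
    [|c0|^2], so [|f|^2 + eps |z|^2], whose second term gains [eps t^2] in the
    mean, has no interior maximum ([no_interior_max]).  This yields the Schwarz
    lemma in the form [bounded_by_inverse_Cmod], and applying it first to [u / z]
    and then to a Moebius transform of [u / z], divided by [z], gives the bound
    on [u2] ([schwarz_second_coefficient]). *)

(** * Power series and their Taylor remainders *)

Lemma pow_n_Cpow (x : C) (k : nat) : pow_n (K := C_AbsRing) x k = Cpow x k.
Proof. induction k as [|k IH]; [reflexivity|simpl; now rewrite IH]. Qed.

Lemma Cmod_triangle_le (x y : C) (a b : R) :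
  Cmod x <= a -> Cmod y <= b -> Cmod (x + y)%C <= a + b.
Proof. intros Hx Hy; pose proof (Cmod_triangle x y); lra. Qed.

Lemma Cmod_minus_le (x y : C) (a b : R) :
  Cmod x <= a -> Cmod y <= b -> Cmod (x - y)%C <= a + b.
Proof.
  intros Hx Hy; apply Cmod_triangle_le; [assumption|now rewrite Cmod_opp].
Qed.

Lemma Cmod_mult_le (x y : C) (a b : R) :
  Cmod x <= a -> Cmod y <= b -> Cmod (x * y)%C <= a * b.
Proof.
  intros Hx Hy; rewrite Cmod_mult.
  apply Rmult_le_compat; auto using Cmod_ge_0.
Qed.

Lemma Cmod_minus_sym (x y : C) : Cmod (x - y)%C = Cmod (y - x)%C.
Proof. rewrite <- Cmod_opp. f_equal; ring. Qed.

Lemma Cpow_lipschitz (x y : C) (s : R) (k : nat) :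
  Cmod x <= s -> Cmod y <= s ->
  Cmod (Cpow x (S k) - Cpow y (S k))%C <= INR (S k) * s ^ k * Cmod (x - y)%C.
Proof.
  intros Hx Hy; induction k as [|k IH].
  - simpl. replace (x * 1 - y * 1)%C with (x - y)%C by ring. lra.
  - replace (Cpow x (S (S k)) - Cpow y (S (S k)))%C
      with (x * (Cpow x (S k) - Cpow y (S k)) + (x - y) * Cpow y (S k))%C
      by (simpl; ring).
    replace (INR (S (S k)) * s ^ S k * Cmod (x - y))
      with (s * (INR (S k) * s ^ k * Cmod (x - y)) + Cmod (x - y) * s ^ S k)
      by (rewrite (S_INR (S k)); simpl pow; ring).
    apply Cmod_triangle_le; apply Cmod_mult_le; try assumption.
    + lra.
    + rewrite Cmod_pow. apply pow_incr; split; [apply Cmod_ge_0|assumption].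
Qed.

Lemma norm_Cmod (x : C) :
  norm (K := C_AbsRing) (V := C_NormedModule) x = Cmod x.
Proof. reflexivity. Qed.

(** A geometric majorant of ratio [1 / 2] has sum [2 b]; partial sums are
    bounded by [b (2 - (1/2)^n)] and the bound passes to the limit. *)
Lemma series_norm_le_geometric (u : nat -> C) (l : C) (b : R) :
  is_series (K := C_AbsRing) (V := C_NormedModule) u l ->
  (forall j, Cmod (u j) <= b * (1 / 2) ^ j) ->
  Cmod l <= 2 * b.
Proof.
  intros Hu Hb.
  assert (b0 : 0 <= b).
  { specialize (Hb 0%nat). simpl in Hb. pose proof (Cmod_ge_0 (u 0%nat)). lra. }
  assert (P : forall n, norm (sum_n (G := C_NormedModule) u n)
                        <= b * (2 - (1 / 2) ^ n)).
  { induction n as [|n IH].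
    - rewrite sum_O. rewrite norm_Cmod. specialize (Hb 0%nat). simpl in *. lra.
    - rewrite sum_Sn. eapply Rle_trans; [apply norm_triangle|].
      rewrite (norm_Cmod (u (S n))).
      specialize (Hb (S n)). simpl pow in *. lra. }
  assert (L : is_lim_seq (fun n => norm (sum_n (G := C_NormedModule) u n))
                (Finite (norm (K := C_AbsRing) (V := C_NormedModule) l))).
  { apply (filterlim_comp _ _ _ _ _ _ _ _ Hu).
    apply (filterlim_norm (K := C_AbsRing) (V := C_NormedModule) l). }
  rewrite <- norm_Cmod.
  apply (is_lim_seq_le _ (fun _ => 2 * b) (Finite _) (Finite (2 * b)))
    with (2 := L) (3 := is_lim_seq_const _).
  intros n. specialize (P n).
  pose proof (pow_le (1 / 2) n ltac:(lra)). nra.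
Qed.

(** The terms of a convergent series are bounded. *)
Lemma pseries_coeff_bound (c : nat -> C) (rho : R) (l : C) :
  0 < rho ->
  is_pseries (K := C_AbsRing) (V := C_NormedModule) c (RtoC rho) l ->
  exists M, 0 <= M /\ forall n, Cmod (c n) * rho ^ n <= M.
Proof.
  intros Hr Hs.
  destruct (filterlim_bounded _ (ex_intro _ l Hs)) as [M HM].
  assert (M0 : 0 <= M) by (apply (Rle_trans _ _ _ (norm_ge_0 _) (HM 0%nat))).
  assert (E : forall n, Cmod (c n) * rho ^ n =
      norm (K := C_AbsRing) (V := C_NormedModule)
      (scal (pow_n (K := C_AbsRing) (RtoC rho) n) (c n : C_NormedModule))).
  { intro n. rewrite pow_n_Cpow.
    change (Cmod (c n) * rho ^ n = Cmod (Cpow (RtoC rho) n * c n)%C).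
    rewrite Cmod_mult, Cmod_pow, Cmod_R, Rabs_right; [ring|lra]. }
  exists (2 * M); split; [lra|]. intros [|n]; rewrite E.
  - specialize (HM 0%nat). rewrite sum_O in HM. lra.
  - set (s := scal _ _).
    assert (s = minus (sum_n (fun k => scal (pow_n (K := C_AbsRing) (RtoC rho) k)
                         (c k : C_NormedModule)) (S n))
                      (sum_n (fun k => scal (pow_n (K := C_AbsRing) (RtoC rho) k)
                         (c k : C_NormedModule)) n)) as ->.
    { rewrite sum_Sn. fold s. set (A := sum_n _ n).
      change ((s : C) = (A + s) - A)%C. ring. }
    replace (2 * M) with (M + M) by ring.
    apply Cmod_minus_le; apply HM.
Qed.

Definition taylor4 (c : nat -> C) (h : C) : C :=
  (c 0%nat + c 1%nat * h + c 2%nat * h ^ 2 + c 3%nat * h ^ 3 + c 4%nat * h ^ 4)%C.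

Lemma INR5_le_pow2 (j : nat) : INR (5 + j) <= 5 * 2 ^ j.
Proof.
  rewrite plus_INR. simpl (INR 5).
  induction j as [|j IH]; [simpl; lra|].
  rewrite S_INR. simpl pow. pose proof (pow_R1_Rle 2 j ltac:(lra)). lra.
Qed.

(** The remainder after degree 4 is [O(s^4)]-Lipschitz on the disk of radius
    [s].  With [y = 0] this is Taylor's formula; with [y] close to [x] it controls
    the derivative of the remainder, which replaces term-by-term differentiation.
    Order 4 is the highest order needed below: the bound on [u2] divides twice
    by [z] and still needs a jet. *)
Lemma pseries_remainder_lipschitz (F : C -> C) (c : nat -> C) (r : R) :
  0 < r ->
  (forall h, Cmod h < r ->
    is_pseries (K := C_AbsRing) (V := C_NormedModule) c h (F h)) ->
  exists K d, 0 <= K /\ 0 < d <= r /\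
    forall x y s, Cmod x <= s -> Cmod y <= s -> s < d ->
      Cmod ((F x - taylor4 c x) - (F y - taylor4 c y))%C
        <= K * s ^ 4 * Cmod (x - y)%C.
Proof.
  intros Hr HF.
  set (rho := r / 2).
  assert (Hrho : 0 < rho) by (unfold rho; lra).
  destruct (pseries_coeff_bound c rho (F (RtoC rho)) Hrho) as [M [HM Hc]].
  { apply HF. rewrite Cmod_R, Rabs_right; unfold rho; lra. }
  exists (2 * (5 * (M / rho ^ 5))), (rho / 4).
  assert (P5 : 0 < rho ^ 5) by (apply pow_lt; assumption).
  assert (MM : 0 <= M / rho ^ 5) by (apply Rdiv_le_0_compat; assumption).
  split; [lra|]. split; [unfold rho in *; lra|].
  intros x y s Hx Hy Hs.
  assert (s0 : 0 <= s) by (pose proof (Cmod_ge_0 x); lra).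
  set (u := fun k => minus (scal (pow_n (K := C_AbsRing) x k) (c k : C_NormedModule))
                           (scal (pow_n (K := C_AbsRing) y k) (c k : C_NormedModule))).
  assert (U : is_series u (minus (F x : C_NormedModule) (F y))).
  { apply (is_series_minus (K := C_AbsRing) (V := C_NormedModule)); apply HF;
      unfold rho in *; lra. }
  assert (Eu : forall k, u k = (c k * (Cpow x k - Cpow y k))%C).
  { intro k. unfold u. rewrite !pow_n_Cpow.
    change (Cpow x k * c k - Cpow y k * c k = c k * (Cpow x k - Cpow y k))%C. ring. }
  assert (T : is_series (fun j => u (5 + j)%nat)
     (((F x - taylor4 c x) - (F y - taylor4 c y))%C : C_NormedModule)).
  { apply is_series_incr_n; [lia|]. simpl Init.Nat.pred.
    rewrite !sum_Sn, sum_O, !Eu.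
    match goal with |- is_series _ ?v =>
      replace v with (minus (F x : C_NormedModule) (F y)); [exact U|] end.
    unfold taylor4.
    change (F x - F y = F x - (c 0%nat + c 1%nat * x + c 2%nat * x ^ 2 + c 3%nat * x ^ 3 + c 4%nat * x ^ 4) - (F y - (c 0%nat + c 1%nat * y + c 2%nat * y ^ 2 + c 3%nat * y ^ 3 + c 4%nat * y ^ 4)) +
      (((((c 0%nat * (x ^ 0 - y ^ 0)) + (c 1%nat * (x ^ 1 - y ^ 1))) + (c 2%nat * (x ^ 2 - y ^ 2))) + (c 3%nat * (x ^ 3 - y ^ 3))) + (c 4%nat * (x ^ 4 - y ^ 4))))%C.
    simpl. ring. }
  replace (2 * (5 * (M / rho ^ 5)) * s ^ 4 * Cmod (x - y))
    with (2 * (5 * (M / rho ^ 5) * s ^ 4 * Cmod (x - y))) by ring.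
  apply (series_norm_le_geometric _ _ _ T).
  intro j. rewrite Eu, Cmod_mult.
  pose proof (Cpow_lipschitz x y s (4 + j) Hx Hy) as L.
  change (S (4 + j)) with (5 + j)%nat in L.
  assert (Cj : Cmod (c (5 + j)%nat) <= M / rho ^ 5 / rho ^ j).
  { apply (Rmult_le_reg_r (rho ^ (5 + j))); [apply pow_lt; lra|].
    eapply Rle_trans; [apply Hc|]. rewrite pow_add. right. field.
    repeat split; try apply pow_nonzero; lra. }
  assert (Sj : s ^ j <= (rho / 4) ^ j) by (apply pow_incr; lra).
  assert (Pj : 0 < rho ^ j) by (apply pow_lt; lra).
  assert (N := INR5_le_pow2 j).
  eapply Rle_trans.
  { apply Rmult_le_compat; [apply Cmod_ge_0|apply Cmod_ge_0|apply Cj|apply L]. }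
  rewrite (pow_add s 4 j).
  assert (Q : INR (5 + j) * s ^ j <= 5 * (1 / 2) ^ j * rho ^ j).
  { eapply Rle_trans.
    - apply Rmult_le_compat; [apply pos_INR|apply pow_le; lra|apply N|apply Sj].
    - right. replace (rho / 4) with (/2 * / 2 * rho) by field.
      replace (1 / 2) with (/ 2) by field.
      rewrite !Rpow_mult_distr, !pow_inv. field. apply pow_nonzero. lra. }
  replace (M / rho ^ 5 / rho ^ j * (INR (5 + j) * (s ^ 4 * s ^ j) * Cmod (x - y)))
    with ((M / rho ^ 5 * s ^ 4 * Cmod (x - y)) / rho ^ j * (INR (5 + j) * s ^ j))
    by (field; split; lra).
  replace (5 * (M / rho ^ 5) * s ^ 4 * Cmod (x - y) * (1 / 2) ^ j)
    with ((M / rho ^ 5 * s ^ 4 * Cmod (x - y)) / rho ^ j * (5 * (1 / 2) ^ j * rho ^ j))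
    by (field; split; lra).
  apply Rmult_le_compat_l; [|exact Q].
  apply Rdiv_le_0_compat; [|assumption].
  apply Rmult_le_pos; [|apply Cmod_ge_0].
  apply Rmult_le_pos; [lra|apply pow_le; lra].
Qed.

(** * Second-order expansions *)

(** The remainder is given pointwise as [h^3] times a bounded number [e], so that
    the jet of a compound expression is an identity checked by [ring] and a bound
    on an explicit [e]. *)
Definition jet (f : C -> C) (z c0 c1 c2 : C) : Prop :=
  exists M d, 0 < d /\
    forall h, Cmod h < d -> exists e, Cmod e <= M /\
      f (z + h)%C = (c0 + c1 * h + c2 * (h * h) + h * h * h * e)%C.

Definition has_jet (f : C -> C) (z : C) : Prop :=
  exists c0 c1 c2, jet f z c0 c1 c2.

(** Bounds the modulus of an expression by that of its atoms; the bound may be an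
    evar, which is then filled with the resulting sum of products. *)
Ltac bound_Cmod :=
  lazymatch goal with
  | |- Cmod (_ + _)%C <= _ => apply Cmod_triangle_le; bound_Cmod
  | |- Cmod (_ - _)%C <= _ => apply Cmod_minus_le; bound_Cmod
  | |- Cmod (_ * _)%C <= _ => apply Cmod_mult_le; bound_Cmod
  | |- _ => first [eassumption | apply Rle_refl]
  end.

(** Splits [H : x < Rmin ... ] into the inequalities with each of the bounds; [H]
    keeps the leftmost one. *)
Ltac min_lt H :=
  repeat match type of H with
  | _ < Rmin ?a ?b =>
      let H1 := fresh H in
      assert (H1 : _ < b) by (exact (Rlt_le_trans _ _ _ H (Rmin_r a b)));
      apply (fun K => Rlt_le_trans _ _ _ K (Rmin_l a b)) in H
  end.

Lemma Cmult_cancel_l (a x y : C) : a <> 0%C -> (a * x = a * y)%C -> x = y.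
Proof.
  intros N E. replace x with (/ a * (a * x))%C by (field; assumption).
  rewrite E. field. assumption.
Qed.

Lemma jet_of_remainder (f : C -> C) (z c0 c1 c2 : C) (K d : R) :
  0 < d ->
  (forall h, Cmod h < d ->
     Cmod (f (z + h) - (c0 + c1 * h + c2 * (h * h)))%C <= K * Cmod h ^ 3) ->
  jet f z c0 c1 c2.
Proof.
  intros Hd H. exists (Rabs K), d. split; [assumption|]. intros h Hh.
  specialize (H h Hh).
  destruct (Ceq_dec h 0) as [->|N].
  - exists 0%C. rewrite Cmod_0 in *. split; [apply Rabs_pos|].
    rewrite pow_i, Rmult_0_r in H by lia.
    set (v := (_ - _)%C) in H.
    assert (v = 0)%C as E.
    { apply Cmod_eq_0. pose proof (Cmod_ge_0 v). lra. }
    unfold v in E.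
    replace (f (z + 0)%C) with (f (z + 0) - (c0 + c1 * 0 + c2 * (0 * 0))
       + (c0 + c1 * 0 + c2 * (0 * 0)))%C by ring.
    rewrite E. ring.
  - exists ((f (z + h) - (c0 + c1 * h + c2 * (h * h))) / (h * h * h))%C.
    assert (N3 : (h * h * h)%C <> 0%C) by (repeat apply Cmult_neq_0; assumption).
    split; [|field; assumption].
    rewrite Cmod_div by assumption.
    assert (0 < Cmod h) by (apply Cmod_gt_0; assumption).
    rewrite !Cmod_mult.
    apply (Rmult_le_reg_r (Cmod h * Cmod h * Cmod h)).
    { repeat apply Rmult_lt_0_compat; assumption. }
    unfold Rdiv. rewrite Rmult_assoc, Rinv_l, Rmult_1_r
      by (apply Rgt_not_eq; repeat apply Rmult_lt_0_compat; assumption).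
    eapply Rle_trans; [exact H|].
    replace (Cmod h ^ 3) with (Cmod h * Cmod h * Cmod h) by ring.
    apply Rmult_le_compat_r; [|apply Rle_abs].
    repeat apply Rmult_le_pos; lra.
Qed.

Lemma jet_ext_loc (f g : C -> C) (z c0 c1 c2 : C) (d : R) :
  0 < d ->
  (forall h, Cmod h < d -> f (z + h)%C = g (z + h)%C) ->
  jet f z c0 c1 c2 -> jet g z c0 c1 c2.
Proof.
  intros Hd E (M & d' & Hd' & H).
  exists M, (Rmin d d'). split; [now apply Rmin_glb_lt|].
  intros h Hh. min_lt Hh. rewrite <- E by assumption. now apply H.
Qed.

Lemma jet_value (f : C -> C) (z c0 c1 c2 : C) : jet f z c0 c1 c2 -> f z = c0.
Proof.
  intros (M & d & Hd & H).
  destruct (H 0%C) as (e & _ & E); [rewrite Cmod_0; assumption|].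
  replace (z + 0)%C with z in E by ring. rewrite E. ring.
Qed.

Lemma jet_const (c z : C) : jet (fun _ => c) z c 0 0.
Proof.
  exists 0, 1. split; [lra|]. intros h _. exists 0%C.
  rewrite Cmod_0. split; [lra|ring].
Qed.

Lemma jet_id (z : C) : jet (fun x => x) z z 1 0.
Proof.
  exists 0, 1. split; [lra|]. intros h _. exists 0%C.
  rewrite Cmod_0. split; [lra|ring].
Qed.

Lemma jet_minus (f g : C -> C) (z c0 c1 c2 d0 d1 d2 : C) :
  jet f z c0 c1 c2 -> jet g z d0 d1 d2 ->
  jet (fun x => f x - g x)%C z (c0 - d0) (c1 - d1) (c2 - d2).
Proof.
  intros (M & d & Hd & H) (M' & d' & Hd' & H').
  eexists. exists (Rmin d d'). split; [now apply Rmin_glb_lt|].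
  intros h Hh. min_lt Hh.
  destruct (H h) as (e & He & ->); [assumption|].
  destruct (H' h) as (e' & He' & ->); [assumption|].
  exists (e - e')%C. split; [bound_Cmod|ring].
Qed.

Lemma jet_mult (f g : C -> C) (z c0 c1 c2 d0 d1 d2 : C) :
  jet f z c0 c1 c2 -> jet g z d0 d1 d2 ->
  jet (fun x => f x * g x)%C z
    (c0 * d0) (c0 * d1 + c1 * d0) (c0 * d2 + c1 * d1 + c2 * d0).
Proof.
  intros (M & d & Hd & H) (M' & d' & Hd' & H').
  eexists. exists (Rmin (Rmin d d') 1).
  split; [repeat apply Rmin_glb_lt; lra|].
  intros h Hh. min_lt Hh. apply Rlt_le in Hh0.
  destruct (H h) as (e & He & ->); [assumption|].
  destruct (H' h) as (e' & He' & ->); [assumption|].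
  exists (c1 * d2 + c2 * d1 + c2 * d2 * h + e * (d0 + d1 * h + d2 * (h * h))
    + (c0 + c1 * h + c2 * (h * h)) * e' + h * h * h * (e * e'))%C.
  split; [bound_Cmod|ring].
Qed.

Lemma jet_inv (f : C -> C) (z c0 c1 c2 : C) :
  c0 <> 0%C -> jet f z c0 c1 c2 -> has_jet (fun x => / f x)%C z.
Proof.
  intros N (M & d & Hd & H).
  assert (N0 : 0 < Cmod c0) by (apply Cmod_gt_0; assumption).
  set (L := Cmod c1 + Cmod c2 * 1 + 1 * 1 * Rabs M).
  assert (L0 : 0 <= L).
  { unfold L. pose proof (Cmod_ge_0 c1); pose proof (Cmod_ge_0 c2);
      pose proof (Rabs_pos M). lra. }
  exists (/ c0)%C, (- c1 / (c0 * c0))%C, ((c1 * c1 - c0 * c2) / (c0 * c0 * c0))%C.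
  eexists. exists (Rmin (Rmin d 1) (Cmod c0 / 2 / (L + 1))).
  assert (0 < Cmod c0 / 2 / (L + 1)) by (repeat apply Rdiv_lt_0_compat; lra).
  split; [repeat apply Rmin_glb_lt; lra|].
  intros h Hh. min_lt Hh. rename Hh1 into H1. apply Rlt_le in H1.
  destruct (H h) as (e & He & E); [assumption|].
  assert (He' : Cmod e <= Rabs M) by (pose proof (Rle_abs M); lra).
  assert (B : Cmod (c1 + c2 * h + h * h * e)%C <= L) by (unfold L; bound_Cmod).
  assert (B2 : Cmod c0 / 2 <= Cmod (f (z + h)%C)).
  { assert (T : Cmod (h * (c1 + c2 * h + h * h * e))%C <= Cmod c0 / 2).
    { rewrite Cmod_mult.
      apply Rle_trans with (Cmod c0 / 2 / (L + 1) * L).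
      - apply Rmult_le_compat; try apply Cmod_ge_0; lra.
      - apply (Rmult_le_reg_r (L + 1)); [lra|].
        replace (Cmod c0 / 2 / (L + 1) * L * (L + 1)) with (Cmod c0 / 2 * L)
          by (field; lra). nra. }
    assert (T2 : Cmod c0 <= Cmod (f (z + h)%C) + Cmod (h * (c1 + c2 * h + h * h * e))%C).
    { rewrite E. eapply Rle_trans; [|apply Cmod_minus_le; apply Rle_refl].
      right. f_equal. ring. }
    lra. }
  assert (N1 : f (z + h)%C <> 0%C).
  { intro Z. rewrite Z, Cmod_0 in B2. lra. }
  assert (B3 : Cmod (/ f (z + h))%C <= / (Cmod c0 / 2)).
  { rewrite Cmod_inv by assumption. apply Rinv_le_contravar; lra. }
  set (q1 := (- c1 / (c0 * c0))%C).
  set (q2 := ((c1 * c1 - c0 * c2) / (c0 * c0 * c0))%C).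
  exists (/ f (z + h) * ((0 - 1) * (c1 * q2 + c2 * q1 + c2 * q2 * h
            + e * (/ c0 + q1 * h + q2 * (h * h)))))%C.
  split; [bound_Cmod|].
  apply (Cmult_cancel_l _ _ _ N1).
  rewrite Cinv_r by assumption.
  replace (f (z + h) * (/ c0 + q1 * h + q2 * (h * h) + h * h * h *
     (/ f (z + h) * ((0 - 1) * (c1 * q2 + c2 * q1 + c2 * q2 * h
            + e * (/ c0 + q1 * h + q2 * (h * h)))))))%C
  with (f (z + h) * (/ c0 + q1 * h + q2 * (h * h)) + (f (z + h) * / f (z + h)) * (h * h * h *
     ((0 - 1) * (c1 * q2 + c2 * q1 + c2 * q2 * h
            + e * (/ c0 + q1 * h + q2 * (h * h))))))%C by ring.
  rewrite Cinv_r by assumption. rewrite E. unfold q1, q2. field. assumption.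
Qed.

(** With [h m] the increment of [f], [|h m|] is at most a constant times [|h|],
    so the increment stays in the domain of the expansion of [g] for small [h]. *)
Lemma jet_comp (f g : C -> C) (z c0 c1 c2 d0 d1 d2 : C) :
  jet f z c0 c1 c2 -> jet g c0 d0 d1 d2 ->
  jet (fun x => g (f x)) z d0 (d1 * c1) (d1 * c2 + d2 * (c1 * c1)).
Proof.
  intros (M & d & Hd & H) (M' & d' & Hd' & H').
  set (L := Cmod c1 + Cmod c2 * 1 + 1 * 1 * Rabs M).
  assert (L0 : 0 <= L).
  { unfold L. pose proof (Cmod_ge_0 c1); pose proof (Cmod_ge_0 c2);
      pose proof (Rabs_pos M). lra. }
  eexists. exists (Rmin (Rmin d 1) (d' / (L + 1))).
  assert (0 < d' / (L + 1)) by (apply Rdiv_lt_0_compat; lra).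
  split; [repeat apply Rmin_glb_lt; lra|].
  intros h Hh. min_lt Hh. rename Hh1 into H1. apply Rlt_le in H1.
  destruct (H h) as (e & He & E); [assumption|].
  assert (He' : Cmod e <= Rabs M) by (pose proof (Rle_abs M); lra).
  set (m := (c1 + c2 * h + h * h * e)%C).
  assert (B : Cmod m <= L) by (unfold L, m; bound_Cmod).
  assert (S : Cmod (h * m)%C < d').
  { rewrite Cmod_mult.
    apply Rle_lt_trans with (d' / (L + 1) * L).
    - apply Rmult_le_compat; try apply Cmod_ge_0; lra.
    - apply (Rmult_lt_reg_r (L + 1)); [lra|].
      replace (d' / (L + 1) * L * (L + 1)) with (d' * L) by (field; lra). nra. }
  destruct (H' _ S) as (e' & Ee' & E').
  replace (f (z + h)%C) with (c0 + h * m)%C by (rewrite E; unfold m; ring).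
  rewrite E'.
  exists (d1 * e + d2 * (c1 * (c2 + h * e) + (c2 + h * e) * m)
          + m * m * m * e')%C.
  split; [bound_Cmod|unfold m; ring].
Qed.

Lemma null_of_linear_bound (a : C) (M d : R) :
  0 < d -> (forall t, 0 < t < d -> Cmod a <= M * t) -> a = 0%C.
Proof.
  intros Hd H. apply Cmod_eq_0.
  destruct (Rle_lt_or_eq_dec _ _ (Cmod_ge_0 a)) as [P|P]; [exfalso|congruence].
  assert (Pd : 0 < Cmod a / 2 / (Rabs M + 1)).
  { pose proof (Rabs_pos M). repeat apply Rdiv_lt_0_compat; lra. }
  set (t := Rmin (d / 2) (Cmod a / 2 / (Rabs M + 1))).
  assert (T : 0 < t < d).
  { unfold t. split; [apply Rmin_glb_lt; lra|].
    pose proof (Rmin_l (d / 2) (Cmod a / 2 / (Rabs M + 1))). lra. }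
  specialize (H t T).
  pose proof (Rmin_r (d / 2) (Cmod a / 2 / (Rabs M + 1)) : t <= _) as T2.
  apply (Rmult_le_compat_r (Rabs M + 1)) in T2; [|pose proof (Rabs_pos M); lra].
  replace (Cmod a / 2 / (Rabs M + 1) * (Rabs M + 1)) with (Cmod a / 2) in T2
    by (field; pose proof (Rabs_pos M); lra).
  pose proof (Rle_abs M). pose proof (Rabs_pos M). nra.
Qed.

(** A polynomial of degree 2 that is [O(h^3)] vanishes; the coefficients are
    killed one after the other by letting [h] tend to 0 along the reals. *)
Lemma jet_unique (f : C -> C) (z c0 c1 c2 d0 d1 d2 : C) :
  jet f z c0 c1 c2 -> jet f z d0 d1 d2 -> c0 = d0 /\ c1 = d1 /\ c2 = d2.
Proof.
  intros Hc Hd.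
  pose proof (jet_value _ _ _ _ _ Hc) as V. rewrite (jet_value _ _ _ _ _ Hd) in V.
  destruct (jet_minus _ _ _ _ _ _ _ _ _ Hc Hd) as (M & d & Pd & H).
  replace (c0 - d0)%C with (RtoC 0) in H by (rewrite V; ring).
  assert (E : forall t, 0 < t < Rmin d 1 -> exists e, Cmod e <= M /\
     (c1 - d1 = - (RtoC t * ((c2 - d2) + RtoC t * e)))%C).
  { intros t [T1 T2]. min_lt T2.
    assert (NT : RtoC t <> 0%C) by (intro Z; injection Z; lra).
    destruct (H (RtoC t)) as (e & He & E).
    { rewrite Cmod_R, Rabs_right; lra. }
    exists e; split; [assumption|].
    apply (Cmult_cancel_l _ _ _ NT).
    set (w := f (z + RtoC t)%C) in E.
    transitivity ((w - w) - (RtoC t * RtoC t * ((c2 - d2) + RtoC t * e)))%C;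
      [rewrite E|]; ring. }
  assert (Pm : 0 < Rmin d 1) by (apply Rmin_glb_lt; lra).
  assert (A1 : (c1 - d1 = 0)%C).
  { apply (null_of_linear_bound _ (Cmod c2 + Cmod d2 + 1 * M) _ Pm).
    intros t T. destruct (E t T) as (e & He & ->).
    destruct T as [T1 T2]. min_lt T2.
    assert (Ct : Cmod (RtoC t) = t) by (rewrite Cmod_R, Rabs_right; lra).
    assert (Ct1 : Cmod (RtoC t) <= 1) by lra.
    rewrite Cmod_opp, Cmod_mult, Ct, Rmult_comm.
    apply Rmult_le_compat_r; [lra|]. bound_Cmod. }
  assert (A2 : (c2 - d2 = 0)%C).
  { apply (null_of_linear_bound _ M _ Pm).
    intros t T. destruct (E t T) as (e & He & E').
    destruct T as [T1 T2]. min_lt T2. rewrite A1 in E'.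
    assert (Ct : Cmod (RtoC t) = t) by (rewrite Cmod_R, Rabs_right; lra).
    assert (NT : RtoC t <> 0%C) by (intro Z; injection Z; lra).
    assert (c2 - d2 = - (RtoC t * e))%C as ->.
    { replace (c2 - d2)%C with ((c2 - d2 + RtoC t * e) - RtoC t * e)%C by ring.
      replace (c2 - d2 + RtoC t * e)%C with (RtoC 0); [ring|].
      apply (Cmult_cancel_l _ _ _ NT).
      replace (RtoC t * 0)%C with (- 0)%C by ring. rewrite E'. ring. }
    rewrite Cmod_opp, Cmod_mult, Ct. nra. }
  split; [symmetry; exact V|].
  split.
  - replace c1 with (c1 - d1 + d1)%C by ring. rewrite A1. ring.
  - replace c2 with (c2 - d2 + d2)%C by ring. rewrite A2. ring.
Qed.

(** * Expansions of analytic functions, derivatives and quotients *)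

Definition local_expansion (f : C -> C) (z : C) (c : nat -> C) (r : R) : Prop :=
  0 < r /\ forall h, Cmod h < r ->
    is_pseries (K := C_AbsRing) (V := C_NormedModule) c h (f (z + h)%C).

Lemma analytic_local_expansion (f : C -> C) (z : C) :
  analytic_in_disk f -> in_disk z -> exists c r, local_expansion f z c r.
Proof.
  intros Ha Hz. destruct (Ha z Hz) as (c & r & Hr & H).
  exists c, r. split; [assumption|]. intros h Hh.
  specialize (H (z + h)%C). replace (z + h - z)%C with h in H by ring. auto.
Qed.

Lemma has_expansion_local (f : C -> C) (a : nat -> C) :
  has_expansion f a -> local_expansion f 0 a 1.
Proof.
  intro H. split; [lra|]. intros h Hh.
  replace (0 + h)%C with h by ring. now apply H.
Qed.

Lemma local_expansion_value (f : C -> C) (z : C) (c : nat -> C) (r : R) :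
  local_expansion f z c r -> f z = c 0%nat.
Proof.
  intros [Hr H].
  assert (H0 := H 0%C). rewrite Cmod_0 in H0. specialize (H0 Hr).
  replace (z + 0)%C with z in H0 by ring.
  apply (filterlim_locally_unique (K := C_AbsRing) (V := C_NormedModule) _ _ _ H0).
  apply (is_pseries_0 (K := C_AbsRing) (V := C_NormedModule) c).
Qed.

Lemma taylor4_remainder (f : C -> C) (z : C) (c : nat -> C) (r : R) :
  local_expansion f z c r ->
  exists K d, 0 <= K /\ 0 < d <= r /\
    forall h, Cmod h < d -> Cmod (f (z + h) - taylor4 c h)%C <= K * Cmod h ^ 5.
Proof.
  intros E. pose proof (local_expansion_value _ _ _ _ E) as V. destruct E as [Hr H].
  destruct (pseries_remainder_lipschitz (fun h => f (z + h)%C) c r Hr H)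
    as (K & d & HK & Hd & L).
  exists K, d. split; [assumption|]. split; [assumption|]. intros h Hh.
  specialize (L h 0%C (Cmod h) (Rle_refl _)). rewrite Cmod_0 in L.
  specialize (L (Cmod_ge_0 h) Hh).
  replace (K * Cmod h ^ 5) with (K * Cmod h ^ 4 * Cmod (h - 0))
    by (replace (h - 0)%C with h by ring; ring).
  eapply Rle_trans; [|exact L]. right. f_equal.
  replace (z + 0)%C with z by ring. rewrite V. unfold taylor4. simpl. ring.
Qed.

Lemma local_expansion_jet (f : C -> C) (z : C) (c : nat -> C) (r : R) :
  local_expansion f z c r -> jet f z (c 0%nat) (c 1%nat) (c 2%nat).
Proof.
  intros E. destruct (taylor4_remainder _ _ _ _ E) as (K & d & HK & Hd & L).
  apply (jet_of_remainder _ _ _ _ _ (K * 1 + (Cmod (c 3%nat) + Cmod (c 4%nat) * 1)) (Rmin d 1)).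
  { apply Rmin_glb_lt; lra. }
  intros h Hh. min_lt Hh. specialize (L h Hh).
  replace (f (z + h) - (c 0%nat + c 1%nat * h + c 2%nat * (h * h)))%C
    with ((f (z + h) - taylor4 c h) + (c 3%nat + c 4%nat * h) * (h * h * h))%C
    by (unfold taylor4; simpl; ring).
  rewrite Rmult_plus_distr_r. apply Rlt_le in Hh0.
  pose proof (Cmod_ge_0 h) as P. pose proof (pow_le _ 3 P) as P3.
  apply Cmod_triangle_le.
  - eapply Rle_trans; [exact L|].
    replace (K * Cmod h ^ 5) with (K * Cmod h ^ 3 * (Cmod h * Cmod h)) by ring.
    replace (K * 1 * Cmod h ^ 3) with (K * Cmod h ^ 3 * (1 * 1)) by ring.
    apply Rmult_le_compat_l; [apply Rmult_le_pos; assumption|].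
    apply Rmult_le_compat; lra.
  - apply Cmod_mult_le; [bound_Cmod|].
    rewrite !Cmod_mult. right. ring.
Qed.

Lemma analytic_has_jet (f : C -> C) (z : C) :
  analytic_in_disk f -> in_disk z -> has_jet f z.
Proof.
  intros Ha Hz. destruct (analytic_local_expansion _ _ Ha Hz) as (c & r & E).
  do 3 eexists. apply (local_expansion_jet _ _ _ _ E).
Qed.

Lemma jet_derive (f : C -> C) (z c0 c1 c2 : C) :
  jet f z c0 c1 c2 -> C_derive f z = c1.
Proof.
  intros J. pose proof (jet_value _ _ _ _ _ J) as V.
  destruct J as (M & d & Hd & H).
  apply is_C_lim_unique. apply filterlim_locally. intro eps.
  set (L := Cmod c2 + 1 * Rabs M).
  assert (L0 : 0 <= L).
  { unfold L. pose proof (Cmod_ge_0 c2); pose proof (Rabs_pos M). lra. }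
  assert (Pe : 0 < Rmin (Rmin d 1) (eps / (L + 1))).
  { repeat apply Rmin_glb_lt; try lra.
    apply Rdiv_lt_0_compat; [apply cond_pos|lra]. }
  assert (Ps : 0 < Rmin (Rmin d 1) (eps / (L + 1)) / 2) by lra.
  exists (mkposreal _ Ps). refine (fun (y : C) Hy Ny => _).
  apply (C_NormedModule_mixin_compat2 z y) in Hy. simpl in Hy.
  assert (Hh : Cmod (y - z)%C < Rmin (Rmin d 1) (eps / (L + 1))).
  { eapply Rlt_le_trans; [exact Hy|].
    assert (sqrt 2 <= 2).
    { rewrite <- (sqrt_square 2) at 2 by lra. apply sqrt_le_1_alt. lra. }
    nra. }
  clear Hy. set (h := (y - z)%C) in *.
  assert (Ey : @eq C y (z + h)%C) by (unfold h; ring).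
  assert (Nh : h <> 0%C).
  { intro Z. apply Ny. change (@eq C y z). rewrite Ey, Z. ring. }
  min_lt Hh. destruct (H h) as (e & He & E); [assumption|].
  apply C_NormedModule_mixin_compat1.
  change (Cmod ((f y - f z) / h - c1)%C < eps).
  rewrite Ey, E, V.
  replace ((c0 + c1 * h + c2 * (h * h) + h * h * h * e - c0) / h - c1)%C
    with ((c2 + h * e) * h)%C by (field; assumption).
  assert (B : Cmod (c2 + h * e)%C <= L).
  { unfold L. apply Rlt_le in Hh1. assert (Cmod e <= Rabs M) by (pose proof (Rle_abs M); lra).
    bound_Cmod. }
  rewrite Cmod_mult.
  assert (Q : Cmod h * (L + 1) < eps).
  { apply (Rmult_lt_reg_r (/ (L + 1))); [apply Rinv_0_lt_compat; lra|].
    rewrite Rmult_assoc, Rinv_r, Rmult_1_r by lra. assumption. }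
  pose proof (proj1 (Cmod_gt_0 h) Nh). nra.
Qed.

(** The first coefficient is a limit of difference quotients. *)
Lemma jet_lipschitz (f : C -> C) (z c0 c1 c2 : C) (L d : R) :
  jet f z c0 c1 c2 -> 0 < d ->
  (forall h, Cmod h < d -> Cmod (f (z + h) - f z)%C <= L * Cmod h) ->
  Cmod c1 <= L.
Proof.
  intros J Hd HL. pose proof (jet_value _ _ _ _ _ J) as V.
  destruct J as (M & d' & Hd' & H).
  set (B := Cmod c2 + 1 * Rabs M).
  assert (B0 : 0 <= B).
  { unfold B. pose proof (Cmod_ge_0 c2); pose proof (Rabs_pos M). lra. }
  apply le_epsilon. intros eps Heps.
  assert (Pe : 0 < Rmin (Rmin (Rmin d d') 1) (eps / (B + 1))).
  { repeat apply Rmin_glb_lt; try lra. apply Rdiv_lt_0_compat; lra. }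
  set (t := Rmin (Rmin (Rmin d d') 1) (eps / (B + 1)) / 2).
  assert (Ht : t < Rmin (Rmin (Rmin d d') 1) (eps / (B + 1))) by (unfold t; lra).
  assert (t0 : 0 < t) by (unfold t; lra). clearbody t. clear Pe.
  min_lt Ht.
  assert (Ct : Cmod (RtoC t) = t) by (rewrite Cmod_R, Rabs_right; lra).
  assert (NT : RtoC t <> 0%C) by (intro Z; injection Z; lra).
  destruct (H (RtoC t)) as (e & He & E); [rewrite Ct; assumption|].
  assert (HL' := HL (RtoC t)). rewrite Ct in HL'. specialize (HL' Ht).
  rewrite E, V in HL'.
  replace (c0 + c1 * t + c2 * (t * t) + t * t * t * e - c0)%C
    with ((c1 + (c2 + RtoC t * e) * t) * t)%C in HL' by ring.
  rewrite Cmod_mult, Ct in HL'. apply Rmult_le_reg_r in HL'; [|assumption].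
  assert (Hb : Cmod ((c2 + RtoC t * e) * t)%C <= B * t).
  { assert (Cmod e <= Rabs M) by (pose proof (Rle_abs M); lra).
    assert (Cmod (RtoC t) <= t) by lra. assert (T1 : Cmod (RtoC t) <= 1) by lra.
    apply Cmod_mult_le; [|lra]. unfold B. clear H1. bound_Cmod. }
  assert (Q : t * (B + 1) < eps).
  { apply (Rmult_lt_reg_r (/ (B + 1))); [apply Rinv_0_lt_compat; lra|].
    rewrite Rmult_assoc, Rinv_r, Rmult_1_r by lra. assumption. }
  replace c1 with ((c1 + (c2 + RtoC t * e) * t) - (c2 + RtoC t * e) * t)%C by ring.
  eapply Rle_trans; [apply Cmod_minus_le; [exact HL'|exact Hb]|]. nra.
Qed.

(** The derivative at [z] exists because [f] has a jet there, and the Lipschitz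
    bound of the remainder on the disk of radius [2 |z|] shows that it differs from
    the derivative of the Taylor polynomial by [O(z^4)]. *)
Lemma derive_jet (f : C -> C) (c : nat -> C) (r : R) :
  analytic_in_disk f -> local_expansion f 0 c r ->
  jet (C_derive f) 0 (c 1%nat) (2 * c 2%nat) (3 * c 3%nat).
Proof.
  intros Ha He. pose proof (local_expansion_jet _ _ _ _ He) as J0.
  destruct He as [Hr He].
  destruct (pseries_remainder_lipschitz (fun h => f (0 + h)%C) c r Hr He)
    as (K & d & HK & Hd & L).
  apply (jet_of_remainder _ _ _ _ _ (K * 16 + 4 * Cmod (c 4%nat)) (Rmin (d / 2) (1 / 2))).
  { apply Rmin_glb_lt; lra. }
  intros z Hz. min_lt Hz.
  replace (0 + z)%C with z by ring.
  destruct (Ceq_dec z 0) as [->|Nz].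
  { rewrite (jet_derive _ _ _ _ _ J0), Cmod_0.
    replace (c 1%nat - (c 1%nat + 2 * c 2%nat * 0 + 3 * c 3%nat * (0 * 0)))%C
      with (RtoC 0) by ring.
    rewrite Cmod_0. simpl. lra. }
  pose proof (proj1 (Cmod_gt_0 z) Nz) as Pz.
  assert (Dz : in_disk z) by (unfold in_disk; lra).
  destruct (analytic_has_jet f z Ha Dz) as (d0 & d1 & d2 & Jz).
  rewrite (jet_derive _ _ _ _ _ Jz).
  set (T' := (c 1%nat + 2 * c 2%nat * z + 3 * c 3%nat * (z * z) + 4 * c 4%nat * (z * z * z))%C).
  assert (JT : exists t0 t2, jet (taylor4 c) z t0 T' t2).
  { exists (taylor4 c z), (c 2%nat + 3 * c 3%nat * z + 6 * c 4%nat * (z * z))%C.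
    eexists. exists 1. split; [lra|]. intros h Hh. apply Rlt_le in Hh.
    exists (c 3%nat + 4 * c 4%nat * z + c 4%nat * h)%C.
    split; [bound_Cmod|]. unfold taylor4, T'. simpl. ring. }
  destruct JT as (t0 & t2 & JT).
  pose proof (jet_lipschitz _ _ _ _ _ (K * (2 * Cmod z) ^ 4) (Cmod z) (jet_minus _ _ _ _ _ _ _ _ _ Jz JT) Pz) as B.
  assert (B' : Cmod (d1 - T')%C <= K * (2 * Cmod z) ^ 4).
  { apply B. intros h Hh.
    replace (Cmod h) with (Cmod ((z + h) - z)%C) by (f_equal; ring).
    specialize (L (z + h)%C z (2 * Cmod z)).
    replace (0 + (z + h))%C with (z + h)%C in L by ring.
    replace (0 + z)%C with z in L by ring.
    apply L; [|lra|lra].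
    replace (2 * Cmod z) with (Cmod z + Cmod z) by ring.
    apply Cmod_triangle_le; lra. }
  replace (d1 - (c 1%nat + 2 * c 2%nat * z + 3 * c 3%nat * (z * z)))%C
    with ((d1 - T') + 4 * c 4%nat * (z * z * z))%C by (unfold T'; ring).
  rewrite Rmult_plus_distr_r. apply Cmod_triangle_le.
  - eapply Rle_trans; [exact B'|].
    replace (K * (2 * Cmod z) ^ 4) with (K * 16 * (Cmod z ^ 3 * Cmod z)) by ring.
    apply Rmult_le_compat_l; [lra|].
    pose proof (pow_le _ 3 (Rlt_le _ _ Pz)). nra.
  - rewrite !Cmod_mult, Cmod_R, Rabs_right by lra. right. ring.
Qed.

(** [u z / z], with the value [c] in the removable singularity. *)
Definition quotient_at_0 (u : C -> C) (c : C) (z : C) : C :=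
  if Ceq_dec z 0 then c else (u z / z)%C.

Lemma quotient_at_0_mult (u : C -> C) (c z : C) :
  u 0 = 0%C -> u z = (z * quotient_at_0 u c z)%C.
Proof.
  intro H. unfold quotient_at_0. destruct (Ceq_dec z 0) as [->|N].
  - rewrite H. ring.
  - field. assumption.
Qed.

Lemma quotient_jet_at_0 (u : C -> C) (c1 c2 c3 : C) (K d : R) :
  0 < d ->
  (forall h, Cmod h < d ->
     Cmod (u h - (c1 * h + c2 * (h * h) + c3 * (h * h * h)))%C <= K * Cmod h ^ 4) ->
  jet (quotient_at_0 u c1) 0 c1 c2 c3.
Proof.
  intros Hd H. apply (jet_of_remainder _ _ _ _ _ (Rabs K) d); [assumption|].
  intros h Hh. replace (0 + h)%C with h by ring. unfold quotient_at_0.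
  destruct (Ceq_dec h 0) as [->|N].
  - replace (c1 - (c1 + c2 * 0 + c3 * (0 * 0)))%C with (RtoC 0) by ring.
    rewrite Cmod_0. simpl. lra.
  - pose proof (proj1 (Cmod_gt_0 h) N) as P.
    apply (Rmult_le_reg_r (Cmod h)); [assumption|]. rewrite <- Cmod_mult.
    replace ((u h / h - (c1 + c2 * h + c3 * (h * h))) * h)%C
      with (u h - (c1 * h + c2 * (h * h) + c3 * (h * h * h)))%C
      by (field; assumption).
    eapply Rle_trans; [apply H; assumption|].
    replace (Rabs K * Cmod h ^ 3 * Cmod h) with (Rabs K * Cmod h ^ 4) by ring.
    apply Rmult_le_compat_r; [apply pow_le; lra|apply Rle_abs].
Qed.

Lemma quotient_has_jet (u : C -> C) (c z : C) :
  z <> 0%C -> has_jet u z -> has_jet (quotient_at_0 u c) z.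
Proof.
  intros N (c0 & c1 & c2 & J).
  destruct (jet_inv _ _ _ _ _ N (jet_id z)) as (d0 & d1 & d2 & J').
  do 3 eexists.
  apply (jet_ext_loc (fun x => u x * / x)%C _ _ _ _ _ (Cmod z)).
  - now apply Cmod_gt_0.
  - intros h Hh. unfold quotient_at_0. destruct (Ceq_dec (z + h) 0) as [Z|_].
    + exfalso. assert (h = - z)%C as ->.
      { replace h with ((z + h) - z)%C by ring. rewrite Z. ring. }
      rewrite Cmod_opp in Hh. lra.
    + reflexivity.
  - apply (jet_mult _ _ _ _ _ _ _ _ _ J J').
Qed.

(** * The maximum principle and Schwarz's lemma *)

(** Compactness of the disk in the form: a property with a local margin [d] holds
    with a uniform margin.  A finite subcover of the enclosing square is used; the
    points outside the disk get neighbourhoods that do not meet it. *)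
Lemma closed_disk_compact (r : R) (Q : C -> R -> Prop) :
  (forall y d d', Q y d -> d' <= d -> Q y d') ->
  (forall z, Cmod z <= r -> exists d, 0 < d /\
     forall y, Cmod y <= r -> Cmod (y - z)%C < d -> Q y d) ->
  exists d, 0 < d /\ forall y, Cmod y <= r -> Q y d.
Proof.
  intros Qd H.
  assert (D : forall z : C, exists d : posreal,
    forall y, Cmod y <= r -> Cmod (y - z)%C < 2 * d -> Q y d).
  { intro z. destruct (Rle_lt_dec (Cmod z) r) as [Hz|Hz].
    - destruct (H z Hz) as (d & Hd & K).
      assert (Pd : 0 < d / 2) by lra. exists (mkposreal _ Pd). simpl.
      intros y Hy Hyz. apply (Qd y d); [apply K; lra|lra].
    - assert (Pd : 0 < (Cmod z - r) / 2) by lra. exists (mkposreal _ Pd). simpl.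
      intros y Hy Hyz. exfalso.
      pose proof (Cmod_triangle y (z - y)) as T.
      rewrite (Cmod_minus_sym z y) in T.
      replace (y + (z - y))%C with z in T by ring. lra. }
  pose (delta := fun u v : R => proj1_sig
          (constructive_indefinite_description _ (D (u, v)))).
  destruct (compactness_value_2d (- r) r (- r) r delta) as [d Hd].
  exists d. split; [apply cond_pos|]. intros [x y] Hy.
  pose proof (Rmax_Cmod (x, y)) as RM. simpl in RM.
  pose proof (Rmax_l (Rabs x) (Rabs y)); pose proof (Rmax_r (Rabs x) (Rabs y)).
  assert (Bx : - r <= x <= r) by (apply Rabs_le_between; lra).
  assert (By : - r <= y <= r) by (apply Rabs_le_between; lra).
  destruct (NNPP _ (Hd x y Bx By)) as (u & v & _ & _ & Xu & Yv & Dd).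
  apply (Qd _ (delta u v)); [|exact Dd].
  unfold delta in *.
  destruct (constructive_indefinite_description _ (D (u, v))) as [e He].
  simpl in *. apply He; [assumption|].
  replace ((x, y) - (u, v))%C with (RtoC (x - u) + Ci * RtoC (y - v))%C
    by (apply injective_projections; simpl; ring).
  eapply Rle_lt_trans; [apply Cmod_triangle|].
  rewrite Cmod_mult, Cmod_Ci, !Cmod_R. lra.
Qed.

(** An upper semicontinuous function attains its maximum.  Compactness is applied
    with the margin [F <= 1 / d] for boundedness, then, if the supremum [M] were not
    attained, with the margin [F <= M - d]. *)
Lemma closed_disk_max (r : R) (F : C -> R) :
  0 <= r ->
  (forall z, Cmod z <= r -> forall eps, 0 < eps -> exists d, 0 < d /\
     forall y, Cmod y <= r -> Cmod (y - z)%C < d -> F y < F z + eps) ->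
  exists z, Cmod z <= r /\ forall y, Cmod y <= r -> F y <= F z.
Proof.
  intros Hr U.
  destruct (closed_disk_compact r (fun y d => 0 < d -> F y <= / d)) as (d & Hd & B).
  { intros y d d' Q Hd' Pd'. eapply Rle_trans; [apply Q; lra|].
    apply Rinv_le_contravar; lra. }
  { intros z Hz. destruct (U z Hz 1 Rlt_0_1) as (d & Hd & K).
    pose proof (Rabs_pos (F z)).
    exists (Rmin d (/ (Rabs (F z) + 1))).
    assert (0 < / (Rabs (F z) + 1)) by (apply Rinv_0_lt_compat; lra).
    split; [apply Rmin_glb_lt; assumption|].
    intros y Hy Hyz P. min_lt Hyz. specialize (K y Hy Hyz).
    apply Rle_trans with (/ / (Rabs (F z) + 1)).
    - rewrite Rinv_inv. pose proof (Rle_abs (F z)). lra.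
    - apply Rinv_le_contravar; [assumption|apply Rmin_r]. }
  destruct (completeness (fun v => exists y, Cmod y <= r /\ v = F y)) as [M [HM1 HM2]].
  { exists (/ d). intros v (y & Hy & ->). now apply B. }
  { exists (F 0). exists 0%C. rewrite Cmod_0. split; [assumption|reflexivity]. }
  apply NNPP. intro N.
  assert (LT : forall z, Cmod z <= r -> F z < M).
  { intros z Hz. destruct (Rlt_le_dec (F z) M) as [?|G]; [assumption|].
    exfalso. apply N. exists z. split; [assumption|]. intros y Hy.
    eapply Rle_trans; [|exact G]. apply HM1. eauto. }
  destruct (closed_disk_compact r (fun y d => F y <= M - d)) as (e & He & B2).
  { intros y d1 d' Q Hd'. lra. }
  { intros z Hz. pose proof (LT z Hz).
    destruct (U z Hz ((M - F z) / 2)) as (d1 & Hd1 & K); [lra|].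
    exists (Rmin d1 ((M - F z) / 2)). split; [apply Rmin_glb_lt; lra|].
    intros y Hy Hyz. min_lt Hyz. specialize (K y Hy Hyz).
    pose proof (Rmin_r d1 ((M - F z) / 2)). lra. }
  assert (M <= M - e); [|lra].
  apply HM2. intros v (y & Hy & ->). now apply B2.
Qed.

Lemma jet_Cmod2_usc (f : C -> C) (z : C) (eps : R) :
  has_jet f z -> 0 < eps -> exists d, 0 < d /\
    forall y, Cmod (y - z)%C < d -> Cmod (f y) ^ 2 < Cmod (f z) ^ 2 + eps.
Proof.
  intros (c0 & c1 & c2 & J) Heps.
  rewrite (jet_value _ _ _ _ _ J). destruct J as (M & d & Hd & H).
  set (L := Cmod c1 + Cmod c2 * 1 + 1 * 1 * Rabs M).
  assert (L0 : 0 <= L).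
  { unfold L. pose proof (Cmod_ge_0 c1); pose proof (Cmod_ge_0 c2);
      pose proof (Rabs_pos M). lra. }
  pose proof (Cmod_ge_0 c0) as P0.
  set (q := eps / (2 * Cmod c0 + 2)).
  assert (q0 : 0 < q) by (apply Rdiv_lt_0_compat; lra).
  set (b := Rmin q 1).
  assert (b0 : 0 < b) by (apply Rmin_glb_lt; lra).
  exists (Rmin (Rmin d 1) (b / (L + 1))).
  split; [repeat apply Rmin_glb_lt; try lra; apply Rdiv_lt_0_compat; lra|].
  intros y Hy. set (h := (y - z)%C) in *.
  min_lt Hy. rename Hy1 into H1. apply Rlt_le in H1.
  destruct (H h) as (e & He & E); [assumption|].
  replace (z + h)%C with y in E by (unfold h; ring).
  assert (He' : Cmod e <= Rabs M) by (pose proof (Rle_abs M); lra).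
  assert (B : Cmod (c1 + c2 * h + h * h * e)%C <= L) by (unfold L; bound_Cmod).
  assert (Q : Cmod h * (L + 1) < b).
  { apply (Rmult_lt_reg_r (/ (L + 1))); [apply Rinv_0_lt_compat; lra|].
    rewrite Rmult_assoc, Rinv_r, Rmult_1_r by lra. assumption. }
  assert (T : Cmod (f y) <= Cmod c0 + b).
  { rewrite E. replace (c0 + c1 * h + c2 * (h * h) + h * h * h * e)%C
      with (c0 + h * (c1 + c2 * h + h * h * e))%C by ring.
    apply Cmod_triangle_le; [lra|]. rewrite Cmod_mult.
    pose proof (Cmod_ge_0 h). nra. }
  pose proof (Cmod_ge_0 (f y)).
  pose proof (Rmin_l q 1 : b <= q). pose proof (Rmin_r q 1 : b <= 1).
  assert (q * (2 * Cmod c0 + 2) = eps) by (unfold q; field; lra).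
  assert (Cmod (f y) ^ 2 <= (Cmod c0 + b) ^ 2) by (apply pow_incr; lra).
  nra.
Qed.

(** The powers of degree 0, 1, 2 are orthogonal on the four fourth roots of
    unity: Parseval's identity for a sum over four points. *)
Lemma quarter_turns_orthogonal (c0 c1 c2 : C) (t : R) :
  let p := fun h : C => (c0 + c1 * h + c2 * (h * h))%C in
  Cmod (p (RtoC t)) ^ 2 + Cmod (p (Ci * RtoC t)%C) ^ 2
    + Cmod (p (- RtoC t)%C) ^ 2 + Cmod (p (- (Ci * RtoC t))%C) ^ 2
  = 4 * (Cmod c0 ^ 2 + Cmod c1 ^ 2 * t ^ 2 + Cmod c2 ^ 2 * t ^ 4).
Proof.
  intros p. unfold p. rewrite !Cmod2_alt.
  destruct c0 as [x0 y0], c1 as [x1 y1], c2 as [x2 y2]. simpl. ring.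
Qed.

Lemma Cmod2_perturb (p e : C) (L m : R) :
  Cmod p <= L -> Cmod e <= m ->
  Cmod p ^ 2 - 2 * L * m <= Cmod (p + e)%C ^ 2.
Proof.
  intros Hp He.
  pose proof (Cmod_ge_0 p); pose proof (Cmod_ge_0 e); pose proof (Cmod_ge_0 (p + e)%C).
  assert (T : Cmod p <= Cmod (p + e)%C + Cmod e).
  { replace p with ((p + e) - e)%C at 1 by ring. apply Cmod_minus_le; lra. }
  assert (Cmod p * Cmod e <= L * m) by (apply Rmult_le_compat; lra).
  destruct (Rle_lt_dec (Cmod e) (Cmod p)); nra.
Qed.

(** Averaging over four points [z + h], [h = t, i t, -t, -i t]: the square of the
    quadratic part does not decrease, [eps |z|^2] gains [eps t^2], and the remainder
    costs only [O(t^3)]. *)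
Lemma no_interior_max (f : C -> C) (z : C) (eps d : R) :
  has_jet f z -> 0 < eps -> 0 < d ->
  exists y, Cmod (y - z)%C < d /\
    Cmod (f z) ^ 2 + eps * Cmod z ^ 2 < Cmod (f y) ^ 2 + eps * Cmod y ^ 2.
Proof.
  intros (c0 & c1 & c2 & J) Heps Hd.
  rewrite (jet_value _ _ _ _ _ J). destruct J as (M & d' & Hd' & H).
  set (L := Cmod c0 + Cmod c1 * 1 + Cmod c2 * (1 * 1)).
  assert (L0 : 0 <= L).
  { unfold L. pose proof (Cmod_ge_0 c0); pose proof (Cmod_ge_0 c1);
      pose proof (Cmod_ge_0 c2). lra. }
  pose proof (Rabs_pos M) as M0.
  assert (LM : 0 <= L * Rabs M) by (apply Rmult_le_pos; assumption).
  assert (Pq : 0 < eps / (2 * (L * Rabs M) + 1)) by (apply Rdiv_lt_0_compat; lra).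
  set (q := Rmin (Rmin (Rmin d d') 1) (eps / (2 * (L * Rabs M) + 1))).
  assert (Pm : 0 < q) by (repeat apply Rmin_glb_lt; lra).
  set (t := q / 2).
  assert (t0 : 0 < t) by (unfold t; lra).
  assert (Ht : t < q) by (unfold t; lra). clearbody t. unfold q in *. clear q.
  min_lt Ht.
  assert (Q : t * (2 * (L * Rabs M) + 1) < eps).
  { apply (Rmult_lt_reg_r (/ (2 * (L * Rabs M) + 1))); [apply Rinv_0_lt_compat; lra|].
    rewrite Rmult_assoc, Rinv_r, Rmult_1_r by lra. assumption. }
  apply NNPP. intro N.
  assert (B : forall h, Cmod h = t ->
    Cmod (c0 + c1 * h + c2 * (h * h))%C ^ 2 - 2 * L * (Rabs M * t ^ 3)
      + eps * Cmod (z + 1 * h + 0 * (h * h))%C ^ 2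
    <= Cmod c0 ^ 2 + eps * Cmod z ^ 2).
  { intros h Eh. destruct (H h) as (e & He & E); [lra|].
    apply Rnot_lt_le. intro K. apply N. exists (z + h)%C.
    replace (z + h - z)%C with h by ring. split; [lra|].
    eapply Rlt_le_trans; [exact K|].
    replace (z + 1 * h + 0 * (h * h))%C with (z + h)%C by ring.
    apply Rplus_le_compat_r. rewrite E.
    assert (Cmod h <= 1) by lra.
    apply Cmod2_perturb; [unfold L; bound_Cmod|].
    rewrite !Cmod_mult, Eh. pose proof (Rle_abs M).
    replace (Rabs M * t ^ 3) with (t * t * t * Rabs M) by ring.
    apply Rmult_le_compat_l; [|lra]. repeat apply Rmult_le_pos; lra. }
  assert (Ct : Cmod (RtoC t) = t) by (rewrite Cmod_R, Rabs_right; lra).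
  assert (Ci1 : Cmod (Ci * RtoC t)%C = t) by (rewrite Cmod_mult, Cmod_Ci, Ct; ring).
  pose proof (B _ Ct) as B1. pose proof (B _ Ci1) as B2.
  pose proof (B (- RtoC t)%C (eq_trans (Cmod_opp _) Ct)) as B3.
  pose proof (B (- (Ci * RtoC t))%C (eq_trans (Cmod_opp _) Ci1)) as B4.
  pose proof (quarter_turns_orthogonal c0 c1 c2 t) as S1.
  pose proof (quarter_turns_orthogonal z 1 0 t) as S2.
  cbv zeta beta in S1, S2. rewrite Cmod_0, Cmod_1 in S2.
  assert (0 <= Cmod c1 ^ 2 * t ^ 2) by (apply Rmult_le_pos; apply pow2_ge_0).
  assert (0 <= Cmod c2 ^ 2 * t ^ 4).
  { apply Rmult_le_pos; [apply pow2_ge_0|apply pow_le; lra]. }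
  assert (t ^ 3 * (2 * (L * Rabs M)) < eps * t ^ 2).
  { replace (t ^ 3 * (2 * (L * Rabs M))) with (t ^ 2 * (t * (2 * (L * Rabs M)))) by ring.
    rewrite (Rmult_comm eps). apply Rmult_lt_compat_l; [apply pow_lt; assumption|]. nra. }
  nra.
Qed.

(** Schwarz's lemma.  On the disk of radius [r], the maximum of
    [|f|^2 + eps |z|^2] lies on the boundary circle, so [|f|^2 <= r^-2 + eps] for all
    [r < 1] and [eps > 0]. *)
Lemma bounded_by_inverse_Cmod (f : C -> C) :
  (forall z, in_disk z -> has_jet f z) ->
  (forall z, in_disk z -> z <> 0%C -> Cmod (f z) <= / Cmod z) ->
  forall z, in_disk z -> Cmod (f z) <= 1.
Proof.
  intros HJ HB z Hz. unfold in_disk in Hz.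
  assert (B : forall r eps, Cmod z <= r -> 0 < r < 1 -> 0 < eps ->
     Cmod (f z) ^ 2 <= (/ r) ^ 2 + eps).
  { intros r eps Hzr Hr Heps.
    destruct (closed_disk_max r (fun y => Cmod (f y) ^ 2 + eps * Cmod y ^ 2))
      as (x & Hx & Hmax); [lra| |].
    - intros x Hx e He.
      destruct (jet_Cmod2_usc f x (e / 2)) as (d & Hd & K);
        [apply HJ; unfold in_disk; lra|lra|].
      assert (He2 : 0 < e / 2 / eps) by (repeat apply Rdiv_lt_0_compat; lra).
      destruct (jet_Cmod2_usc (fun y => y) x (e / 2 / eps)) as (d' & Hd' & K');
        [do 3 eexists; apply jet_id|assumption|].
      exists (Rmin d d'). split; [now apply Rmin_glb_lt|].
      intros y _ Hy. min_lt Hy. specialize (K y Hy). specialize (K' y Hy0).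
      apply (Rmult_lt_compat_l eps) in K'; [|assumption].
      replace (eps * (Cmod x ^ 2 + e / 2 / eps)) with (eps * Cmod x ^ 2 + e / 2) in K'
        by (field; lra).
      lra.
    - assert (Ex : Cmod x = r).
      { destruct (Rle_lt_or_eq_dec _ _ Hx) as [Lx|Ex]; [exfalso|assumption].
        destruct (no_interior_max f x eps (r - Cmod x)) as (y & Hy & K);
          [apply HJ; unfold in_disk; lra|lra|lra|].
        assert (Cmod y <= r).
        { replace y with (x + (y - x))%C by ring.
          eapply Rle_trans; [apply Cmod_triangle|lra]. }
        specialize (Hmax y ltac:(assumption)). lra. }
      specialize (Hmax z Hzr).
      assert (Cmod (f x) <= / r).
      { rewrite <- Ex. apply HB; [unfold in_disk; lra|].
        apply Cmod_gt_0. lra. }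
      assert (Cmod (f x) ^ 2 <= (/ r) ^ 2).
      { apply pow_incr. split; [apply Cmod_ge_0|assumption]. }
      assert (0 <= Cmod z ^ 2) by apply pow2_ge_0.
      rewrite Ex in Hmax. 
      assert (eps * r ^ 2 <= eps * 1) by (apply Rmult_le_compat_l; nra).
      assert (0 <= eps * Cmod z ^ 2) by (apply Rmult_le_pos; lra). lra. }
  apply Rnot_lt_le. intro N.
  (* [r' < 1] with [|z| <= r'] and [1 / r' < |f z|] contradicts [B]. *)
  set (A := Cmod (f z)) in *.
  set (r := Rmax (Cmod z) (Rmax (1 / 2) (/ A)) : R).
  set (r' := (r + 1) / 2).
  assert (HA : / A < 1) by (rewrite <- Rinv_1; apply Rinv_lt_contravar; lra).
  assert (Pr : r < 1) by (unfold r; repeat apply Rmax_lub_lt; lra).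
  pose proof (Rmax_l (Cmod z) (Rmax (1 / 2) (/ A)) : _ <= r).
  pose proof (Rmax_r (Cmod z) (Rmax (1 / 2) (/ A)) : _ <= r).
  pose proof (Rmax_l (1 / 2) (/ A)). pose proof (Rmax_r (1 / 2) (/ A)).
  assert (Hr' : / A < r' < 1) by (unfold r'; lra).
  assert (HrA : / r' < A).
  { rewrite <- (Rinv_inv A). apply Rinv_lt_contravar; [|lra].
    apply Rmult_lt_0_compat; [apply Rinv_0_lt_compat; lra|unfold r'; lra]. }
  assert (Pr' : 0 < / r') by (apply Rinv_0_lt_compat; unfold r'; lra).
  specialize (B r' ((A ^ 2 - (/ r') ^ 2) / 2)).
  assert ((/ r') ^ 2 < A ^ 2) by nra.
  assert (A ^ 2 <= (/ r') ^ 2 + (A ^ 2 - (/ r') ^ 2) / 2).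
  { apply B; [unfold r'; lra|unfold r' in *; lra|lra]. }
  lra.
Qed.

(** * The coefficient inequality for Schwarz functions and starlike quotients *)

Lemma local_expansion_quotient_jet (f : C -> C) (c : nat -> C) (r : R) :
  local_expansion f 0 c r -> c 0%nat = RtoC 0 ->
  jet (quotient_at_0 f (c 1%nat)) 0 (c 1%nat) (c 2%nat) (c 3%nat).
Proof.
  intros E V. destruct (taylor4_remainder _ _ _ _ E) as (K & d & HK & Hd & T).
  apply (quotient_jet_at_0 _ _ _ _ (K * 1 + Cmod (c 4%nat)) (Rmin d 1)).
  { apply Rmin_glb_lt; lra. }
  intros h Hh. min_lt Hh. specialize (T h Hh).
  replace (0 + h)%C with h in T by ring.
  replace (f h - (c 1%nat * h + c 2%nat * (h * h) + c 3%nat * (h * h * h)))%C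
    with ((f h - taylor4 c h) + c 4%nat * (h * h * h * h))%C
    by (unfold taylor4; rewrite V; simpl; ring).
  rewrite Rmult_plus_distr_r. apply Cmod_triangle_le.
  - eapply Rle_trans; [exact T|].
    replace (K * Cmod h ^ 5) with (K * Cmod h ^ 4 * Cmod h) by ring.
    replace (K * 1 * Cmod h ^ 4) with (K * Cmod h ^ 4 * 1) by ring.
    apply Rmult_le_compat_l; [|lra].
    apply Rmult_le_pos; [assumption|apply pow_le, Cmod_ge_0].
  - rewrite !Cmod_mult. right. ring.
Qed.

Lemma quotient_has_jet_in_disk (u : C -> C) (c0 c1 c2 z : C) :
  (in_disk z -> has_jet u z) -> jet (quotient_at_0 u c0) 0 c0 c1 c2 ->
  in_disk z -> has_jet (quotient_at_0 u c0) z.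
Proof.
  intros H J Hz. destruct (Ceq_dec z 0) as [->|N].
  - now exists c0, c1, c2.
  - apply quotient_has_jet; auto.
Qed.

(** The difference of the squares is [(1 - |a|^2) (1 - |w|^2)]. *)
Lemma moebius_bound (a w : C) :
  Cmod a <= 1 -> Cmod w <= 1 -> Cmod (w - a)%C <= Cmod (1 - Cconj a * w)%C.
Proof.
  intros Ha Hw.
  assert (I : Cmod (1 - Cconj a * w)%C ^ 2 - Cmod (w - a)%C ^ 2
              = (1 - Cmod a ^ 2) * (1 - Cmod w ^ 2)).
  { rewrite !Cmod2_alt. destruct a as [a b], w as [x y]. simpl. ring. }
  pose proof (Cmod_ge_0 a); pose proof (Cmod_ge_0 w).
  pose proof (Cmod_ge_0 (w - a)%C); pose proof (Cmod_ge_0 (1 - Cconj a * w)%C).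
  assert (0 <= 1 - Cmod a ^ 2) by nra. assert (0 <= 1 - Cmod w ^ 2) by nra.
  assert (0 <= (1 - Cmod a ^ 2) * (1 - Cmod w ^ 2)) by (now apply Rmult_le_pos).
  nra.
Qed.

Lemma one_minus_neq_0 (w : C) : Cmod w < 1 -> (1 - w)%C <> 0%C.
Proof.
  intros H E. assert (w = 1%C) as ->.
  { replace w with (1 - (1 - w))%C by ring. rewrite E. ring. }
  rewrite Cmod_1 in H. lra.
Qed.

(** Let [p = u / z] and [a = p(0)], so [|p| <= 1] by Schwarz's lemma.  For
    [0 < t < 1] the function [(t p - t a) / (1 - t^2 conj(a) p)] maps the disk into
    itself and vanishes at 0, so Schwarz's lemma bounds its derivative
    [t c2 / (1 - t^2 |a|^2)] by 1.  The factor [t] keeps the denominator away from 0,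
    also when [|a| = 1]; it is removed by letting it tend to 1. *)
Lemma schwarz_second_coefficient (u : C -> C) (c : nat -> C) (r : R) :
  schwarz_function u -> local_expansion u 0 c r ->
  Cmod (c 2%nat) <= 1 - Cmod (c 1%nat) ^ 2.
Proof.
  intros (Ua & U0 & Ud) E.
  pose proof (local_expansion_value _ _ _ _ E) as V. rewrite U0 in V.
  destruct (taylor4_remainder _ _ _ _ E) as (K & d & HK & Hd & T).
  set (p := quotient_at_0 u (c 1%nat)).
  assert (Jp : jet p 0 (c 1%nat) (c 2%nat) (c 3%nat))
    by (now apply (local_expansion_quotient_jet u c r)).
  assert (HJp : forall z, in_disk z -> has_jet p z).
  { intros z Hz. apply (quotient_has_jet_in_disk u _ _ _ z) with (2 := Jp); [|assumption].
    intro. now apply analytic_has_jet. }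
  assert (Bp : forall z, in_disk z -> Cmod (p z) <= 1).
  { apply bounded_by_inverse_Cmod; [assumption|].
    intros z Hz N. unfold p, quotient_at_0. destruct (Ceq_dec z 0); [contradiction|].
    rewrite Cmod_div by assumption.
    pose proof (proj1 (Cmod_gt_0 z) N). pose proof (Ud z Hz) as U. unfold in_disk in U.
    unfold Rdiv. rewrite <- (Rmult_1_l (/ Cmod z)) at 2.
    apply Rmult_le_compat_r; [left; now apply Rinv_0_lt_compat|lra]. }
  assert (D0 : in_disk 0) by (unfold in_disk; rewrite Cmod_0; lra).
  pose proof (jet_value _ _ _ _ _ Jp) as Vp.
  set (a := c 1%nat) in *.
  assert (Ba : Cmod a <= 1) by (rewrite <- Vp; now apply Bp).
  set (pa := fun z => (p z - a)%C).
  set (s := quotient_at_0 pa (c 2%nat)).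
  assert (Js : jet s 0 (c 2%nat) (c 3%nat) (c 4%nat)).
  { apply (quotient_jet_at_0 _ _ _ _ K d); [lra|].
    intros h Hh. specialize (T h Hh). replace (0 + h)%C with h in T by ring.
    destruct (Ceq_dec h 0) as [->|N].
    { unfold pa. rewrite Vp.
      replace (a - a - (c 2%nat * 0 + c 3%nat * (0 * 0) + c 4%nat * (0 * 0 * 0)))%C
        with (RtoC 0) by ring.
      rewrite Cmod_0. simpl. lra. }
    pose proof (proj1 (Cmod_gt_0 h) N) as P.
    apply (Rmult_le_reg_r (Cmod h)); [assumption|]. rewrite <- Cmod_mult.
    replace (K * Cmod h ^ 4 * Cmod h) with (K * Cmod h ^ 5) by ring.
    eapply Rle_trans; [|exact T]. right. f_equal.
    rewrite (quotient_at_0_mult u a h U0). fold p. unfold pa, taylor4.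
    rewrite <- V. fold a. simpl. ring. }
  assert (HJs : forall z, in_disk z -> has_jet s z).
  { intros z Hz. apply (quotient_has_jet_in_disk pa _ _ _ z) with (2 := Js); [|assumption].
    intros _. destruct (HJp z Hz) as (d0 & d1 & d2 & J). do 3 eexists.
    apply (jet_minus _ _ _ _ _ _ _ _ _ J (jet_const a z)). }
  assert (Es : forall z, (p z - a = z * s z)%C).
  { intro z. apply (quotient_at_0_mult pa). unfold pa. rewrite Vp. ring. }
  assert (Bt : forall t, 0 < t < 1 -> t * Cmod (c 2%nat) <= 1 - t ^ 2 * Cmod a ^ 2).
  { intros t Ht.
    assert (Ct : Cmod (RtoC t) = t) by (rewrite Cmod_R, Rabs_right; lra).
    assert (St : forall b, Cmod b <= 1 -> Cmod (RtoC t * b)%C < 1).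
    { intros b Hb. rewrite Cmod_mult, Ct. pose proof (Cmod_ge_0 b). nra. }
    set (den := fun z => (1 - Cconj (RtoC t * a) * (RtoC t * p z))%C).
    assert (Nd : forall z, in_disk z -> den z <> 0%C).
    { intros z Hz. apply one_minus_neq_0. rewrite Cmod_mult, Cmod_conj.
      pose proof (St a Ba). pose proof (St _ (Bp z Hz)).
      pose proof (Cmod_ge_0 (RtoC t * a)%C). pose proof (Cmod_ge_0 (RtoC t * p z)%C).
      nra. }
    set (q := fun z => (RtoC t * s z * / den z)%C).
    assert (Q0 : Cmod (q 0) <= 1).
    { apply (bounded_by_inverse_Cmod q); [| |exact D0].
      - intros z Hz. destruct (HJs z Hz) as (s0 & s1 & s2 & J1).
        destruct (HJp z Hz) as (p0 & p1 & p2 & J2).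
        pose proof (jet_minus _ _ _ _ _ _ _ _ _ (jet_const 1 z)
           (jet_mult _ _ _ _ _ _ _ _ _ (jet_const (Cconj (RtoC t * a)) z)
              (jet_mult _ _ _ _ _ _ _ _ _ (jet_const (RtoC t) z) J2))) as J3.
        cbv beta in J3. fold den in J3.
        pose proof (jet_value _ _ _ _ _ J3) as V3.
        assert (N3 := Nd z Hz).
        change (den z = 1 - Cconj (RtoC t * a) * (RtoC t * p0))%C in V3.
        rewrite V3 in N3.
        destruct (jet_inv _ _ _ _ _ N3 J3) as (i0 & i1 & i2 & J4).
        do 3 eexists.
        exact (jet_mult _ _ _ _ _ _ _ _ _
                (jet_mult _ _ _ _ _ _ _ _ _ (jet_const (RtoC t) z) J1) J4).
      - intros z Hz N. pose proof (proj1 (Cmod_gt_0 z) N) as P.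
        apply (Rmult_le_reg_l (Cmod z)); [assumption|].
        rewrite Rinv_r by lra. rewrite <- Cmod_mult.
        assert (N' := Nd z Hz).
        replace (z * q z)%C with ((RtoC t * p z - RtoC t * a) / den z)%C.
        2:{ replace (RtoC t * p z - RtoC t * a)%C with (RtoC t * (p z - a))%C by ring.
            rewrite Es. unfold q. field. assumption. }
        rewrite Cmod_div by assumption.
        apply (Rmult_le_reg_r (Cmod (den z))); [now apply Cmod_gt_0|].
        unfold Rdiv. rewrite Rmult_assoc, Rinv_l, Rmult_1_r, Rmult_1_l
          by (apply Rgt_not_eq; now apply Cmod_gt_0).
        apply moebius_bound; left; auto. }
    assert (Dv : den 0 = RtoC (1 - t ^ 2 * Cmod a ^ 2)).
    { unfold den. rewrite Vp, Cmod2_alt. destruct a as [x y].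
      apply injective_projections; simpl; ring. }
    assert (Pd : 0 < 1 - t ^ 2 * Cmod a ^ 2).
    { pose proof (St a Ba) as S. rewrite Cmod_mult, Ct in S.
      replace (1 - t ^ 2 * Cmod a ^ 2) with (1 - (t * Cmod a) ^ 2) by ring.
      pose proof (Cmod_ge_0 a). assert (0 <= t * Cmod a) by nra. nra. }
    unfold q in Q0. rewrite Dv, (jet_value _ _ _ _ _ Js) in Q0.
    rewrite !Cmod_mult, Ct, Cmod_inv in Q0.
    2:{ intro Z. injection Z. lra. }
    rewrite Cmod_R, Rabs_right in Q0 by lra.
    apply (Rmult_le_compat_r (1 - t ^ 2 * Cmod a ^ 2)) in Q0; [|lra].
    rewrite Rmult_assoc, Rinv_l, Rmult_1_r, Rmult_1_l in Q0 by lra. exact Q0. }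
  apply Rnot_lt_le. intro N.
  pose proof (Cmod_ge_0 (c 2%nat)). pose proof (Cmod_ge_0 a).
  set (A := Cmod (c 2%nat)) in *. set (b := Cmod a ^ 2) in *.
  assert (b0 : 0 <= b) by apply pow2_ge_0.
  assert (b1 : b <= 1) by (unfold b; nra).
  set (e := Rmin (1 / 2) ((A - (1 - b)) / (2 * (A + 2)))).
  assert (e0 : 0 < e) by (apply Rmin_glb_lt; [lra|apply Rdiv_lt_0_compat; lra]).
  assert (e1 : e <= 1 / 2) by apply Rmin_l.
  assert (e2 : e * (A + 2) <= (A - (1 - b)) / 2).
  { apply (Rmult_le_reg_r (/ (A + 2))); [apply Rinv_0_lt_compat; lra|].
    rewrite Rmult_assoc, Rinv_r, Rmult_1_r by lra.
    eapply Rle_trans; [apply Rmin_r|]. right. field. lra. }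
  specialize (Bt (1 - e) ltac:(lra)).
  assert (e * b <= e * 1) by (apply Rmult_le_compat_l; lra).
  assert (0 <= e * e * b) by (repeat apply Rmult_le_pos; lra).
  nra.
Qed.

(** Both sides of [f' = (f / z) (phi o u)] have explicit jets at 0; the identity
    also holds at 0, both sides being 1 there.  Univalence gives [f z <> 0] for
    [z <> 0]. *)
Lemma starlike_coefficients (phi f : C -> C) (B a : nat -> C) (r s : R) :
  local_expansion phi 0 B s -> B 0%nat = RtoC 1 ->
  univalent f -> local_expansion f 0 a r ->
  a 0%nat = RtoC 0 -> a 1%nat = RtoC 1 ->
  subordinate (starlike_quotient f) phi ->
  exists u1 u2 : C, Cmod u2 <= 1 - Cmod u1 ^ 2 /\
    a 2%nat = (B 1%nat * u1)%C /\
    (2 * a 3%nat = a 2%nat * a 2%nat + B 1%nat * u2 + B 2%nat * (u1 * u1))%C.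
Proof.
  intros HB B0 [Fa Fi] Ef a0 a1 (u & Su & Eu).
  assert (D0 : in_disk 0) by (unfold in_disk; rewrite Cmod_0; lra).
  pose proof (local_expansion_value _ _ _ _ Ef) as F0. rewrite a0 in F0.
  destruct Su as (Ua & U0 & Ud).
  destruct (analytic_local_expansion u 0 Ua D0) as (c & ru & Ec).
  exists (c 1%nat), (c 2%nat).
  split; [apply (schwarz_second_coefficient u c ru); [split; auto|assumption]|].
  pose proof (derive_jet f a r Fa Ef) as Jd. rewrite a1 in Jd.
  pose proof (local_expansion_jet _ _ _ _ Ec) as Ju.
  pose proof (local_expansion_value _ _ _ _ Ec) as V. rewrite U0 in V.
  rewrite <- V in Ju.
  pose proof (local_expansion_jet _ _ _ _ HB) as Jphi.
  pose proof (jet_comp _ _ _ _ _ _ _ _ _ Ju Jphi) as Jc. rewrite B0 in Jc.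
  assert (Jq : jet (quotient_at_0 f 1) 0 1 (a 2%nat) (a 3%nat)).
  { rewrite <- a1. now apply (local_expansion_quotient_jet f a r). }
  pose proof (jet_mult _ _ _ _ _ _ _ _ _ Jq Jc) as Jm.
  assert (Jd' : jet (fun z => quotient_at_0 f 1 z * phi (u z))%C 0 1 (2 * a 2%nat) (3 * a 3%nat)).
  { apply (jet_ext_loc (C_derive f) _ _ _ _ _ 1); [lra| |exact Jd].
    intros z Hz. replace (0 + z)%C with z by ring.
    destruct (Ceq_dec z 0) as [->|N].
    - rewrite (jet_value _ _ _ _ _ Jd), (jet_value _ _ _ _ _ Jq), (jet_value _ _ _ _ _ Jc).
      ring.
    - rewrite <- Eu by assumption. unfold starlike_quotient, quotient_at_0.
      destruct (Ceq_dec z 0); [contradiction|].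
      assert (f z <> 0%C).
      { intro Z. apply N. apply Fi; [assumption|assumption|]. now rewrite F0. }
      field. now split. }
  destruct (jet_unique _ _ _ _ _ _ _ _ Jd' Jm) as (_ & E1 & E2).
  assert (A2 : a 2%nat = (B 1%nat * c 1%nat)%C).
  { replace (a 2%nat) with (2 * a 2%nat - a 2%nat)%C by ring. rewrite E1. ring. }
  split; [assumption|].
  replace (2 * a 3%nat)%C with (3 * a 3%nat - a 3%nat)%C by ring.
  rewrite E2. rewrite A2 at 3. rewrite A2. ring.
Qed.

(** * Coefficients of the inverse, and the bounds *)

(** First [b1 = 1] from the jet of [g o f = id].  The third coefficient lies
    outside the reach of that jet, and is read off the identity
    [(g(w) / w)(f z) * (f z / z) = 1] instead. *)
Lemma inverse_coefficients (f g : C -> C) (a b : nat -> C) (r s d : R) :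
  local_expansion f 0 a r -> a 0%nat = RtoC 0 -> a 1%nat = RtoC 1 ->
  local_expansion g 0 b s -> 0 < d ->
  (forall z, Cmod z < 1 -> Cmod (f z) < d -> g (f z) = z) ->
  b 0%nat = RtoC 0 /\ b 1%nat = RtoC 1 /\ b 2%nat = (- a 2%nat)%C /\
  b 3%nat = (2 * (a 2%nat * a 2%nat) - a 3%nat)%C.
Proof.
  intros Ef a0 a1 Eg Hd GF.
  pose proof (local_expansion_value _ _ _ _ Ef) as F0. rewrite a0 in F0.
  pose proof (local_expansion_jet _ _ _ _ Ef) as Jf. rewrite a0, a1 in Jf.
  pose proof (local_expansion_jet _ _ _ _ Eg) as Jg.
  pose proof (local_expansion_value _ _ _ _ Eg) as G0.
  assert (b0 : b 0%nat = RtoC 0).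
  { rewrite <- G0. rewrite <- F0 at 1. apply GF; [rewrite Cmod_0; lra|].
    rewrite F0, Cmod_0. exact Hd. }
  destruct (jet_Cmod2_usc f 0 (d ^ 2)) as (e & He & K).
  { do 3 eexists; exact Jf. }
  { now apply pow_lt. }
  assert (GF' : forall z, Cmod z < Rmin e 1 -> g (f z) = z).
  { intros z Hz. min_lt Hz. apply GF; [assumption|].
    specialize (K z). replace (z - 0)%C with z in K by ring. specialize (K Hz).
    rewrite F0, Cmod_0, pow_i, Rplus_0_l in K by lia.
    apply Rnot_le_lt. intro N. pose proof (pow_incr d _ 2 (conj (Rlt_le _ _ Hd) N)). lra. }
  assert (He1 : 0 < Rmin e 1) by (apply Rmin_glb_lt; lra).
  assert (b1 : b 1%nat = RtoC 1).
  { pose proof (jet_comp _ _ _ _ _ _ _ _ _ Jf Jg) as Jc.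
    assert (J1 : jet (fun z => g (f z)) 0 0 1 0).
    { apply (jet_ext_loc (fun z => z) _ _ _ _ _ (Rmin e 1)); [assumption| |apply jet_id].
      intros h Hh. replace (0 + h)%C with h by ring. symmetry. now apply GF'. }
    destruct (jet_unique _ _ _ _ _ _ _ _ Jc J1) as (_ & E & _).
    rewrite <- E. ring. }
  pose proof (local_expansion_quotient_jet _ _ _ Ef a0) as Jqf.
  pose proof (local_expansion_quotient_jet _ _ _ Eg b0) as Jqg.
  rewrite a1 in Jqf. rewrite b1 in Jqg.
  set (qf := quotient_at_0 f 1) in *. set (qg := quotient_at_0 g 1) in *.
  pose proof (jet_mult _ _ _ _ _ _ _ _ _ (jet_comp _ _ _ _ _ _ _ _ _ Jf Jqg) Jqf) as Jm.
  cbv beta in Jm.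
  assert (J1 : jet (fun z => qg (f z) * qf z)%C 0 1 0 0).
  { apply (jet_ext_loc (fun _ => RtoC 1) _ _ _ _ _ (Rmin e 1)); [assumption| |apply jet_const].
    intros h Hh. replace (0 + h)%C with h by ring.
    destruct (Ceq_dec h 0) as [->|N].
    - rewrite F0, (jet_value _ _ _ _ _ Jqf), (jet_value _ _ _ _ _ Jqg). ring.
    - pose proof (GF' h Hh) as E. unfold qf, qg, quotient_at_0.
      destruct (Ceq_dec h 0); [contradiction|].
      destruct (Ceq_dec (f h) 0) as [Z|Nf].
      + exfalso. rewrite Z, G0, b0 in E. auto.
      + rewrite E. field. now split. }
  destruct (jet_unique _ _ _ _ _ _ _ _ Jm J1) as (_ & E1 & E2).
  split; [assumption|]. split; [assumption|].
  assert (B2 : b 2%nat = (- a 2%nat)%C).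
  { replace (- a 2%nat)%C with (0 - a 2%nat)%C by ring. rewrite <- E1. ring. }
  split; [assumption|].
  rewrite B2 in E2.
  replace (2 * (a 2%nat * a 2%nat) - a 3%nat)%C with (0 + 2 * (a 2%nat * a 2%nat) - a 3%nat)%C by ring.
  rewrite <- E2. ring.
Qed.

(** The fourth hypothesis confines [x2 ^ 2] to [0 <= x2 ^ 2 <= b^3 / (D + b)].  The
    fifth bounds [x3] by an affine function of [x2 ^ 2], hence by the larger of its
    end values: [b / 2] at 0 and, if [D <= 2 b^2], [b^3 / (D + b)] at the other end. *)
Lemma bounds_of_linear_bounds (x2 x3 b D : R) :
  0 <= x2 -> 0 < b -> 0 <= D ->
  D * x2 ^ 2 <= b * (b ^ 2 - x2 ^ 2) ->
  2 * b ^ 2 * x3 <= Rmax 0 (2 * b ^ 2 - D) * x2 ^ 2 + b * (b ^ 2 - x2 ^ 2) ->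
  x2 <= b * sqrt b / sqrt (D + b) /\
  x3 <= Rmax (b ^ 3 / (D + b)) (b / 2).
Proof.
  intros H2 Hb HD N1 N3.
  assert (P2 : 0 <= x2 ^ 2) by apply pow2_ge_0.
  assert (Pb : 0 < b ^ 2) by (apply pow_lt; assumption).
  set (M := b ^ 3 / (D + b)).
  assert (EM : M * (D + b) = b ^ 3) by (unfold M; field; lra).
  assert (AM : x2 ^ 2 <= M).
  { apply (Rmult_le_reg_r (D + b)); [lra|]. rewrite EM. lra. }
  split.
  - apply Rnot_lt_le. intro N.
    set (y := b * sqrt b / sqrt (D + b)) in *.
    assert (S0 : 0 < sqrt (D + b)) by (apply sqrt_lt_R0; lra).
    assert (y0 : 0 <= y).
    { apply Rdiv_le_0_compat; [|assumption].
      apply Rmult_le_pos; [lra|apply sqrt_pos]. }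
    assert (Ey : y ^ 2 = M).
    { unfold y, M, Rdiv. rewrite !Rpow_mult_distr, pow_inv, !pow2_sqrt by lra.
      field. lra. }
    nra.
  - destruct (Rle_lt_dec (2 * b ^ 2 - D) 0) as [L|G].
    + rewrite Rmax_left in N3 by lra.
      apply Rle_trans with (b / 2); [|apply Rmax_r].
      apply (Rmult_le_reg_l (2 * b ^ 2)); [lra|].
      replace (2 * b ^ 2 * (b / 2)) with (b * b ^ 2) by field.
      assert (0 <= b * x2 ^ 2) by (apply Rmult_le_pos; lra). lra.
    + rewrite Rmax_right in N3 by lra.
      (* The bound is affine in [x2 ^ 2], which ranges between 0 and [M]. *)
      destruct (Rle_lt_dec (2 * b ^ 2 - D - b) 0) as [L'|G'].
      * apply Rle_trans with (b / 2); [|apply Rmax_r].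
        apply (Rmult_le_reg_l (2 * b ^ 2)); [lra|].
        replace (2 * b ^ 2 * (b / 2)) with (b ^ 3) by field.
        assert ((2 * b ^ 2 - D - b) * x2 ^ 2 <= 0) by nra. lra.
      * apply Rle_trans with M; [|apply Rmax_l].
        apply (Rmult_le_reg_l (2 * b ^ 2)); [lra|].
        assert ((2 * b ^ 2 - D - b) * x2 ^ 2 <= (2 * b ^ 2 - D - b) * M)
          by (apply Rmult_le_compat_l; lra).
        lra.
Qed.

Lemma Cmod_combination_le (p q b rho : R) (u v : C) :
  Cmod u <= rho -> Cmod v <= rho -> 0 <= p -> 0 <= q -> 0 <= b ->
  Cmod (RtoC (b * p) * u + RtoC (b * q) * v)%C <= b * (p + q) * rho.
Proof.
  intros Hu Hv Hp Hq Hb.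
  replace (b * (p + q) * rho) with (b * p * rho + b * q * rho) by ring.
  apply Cmod_triangle_le; apply Cmod_mult_le; try assumption;
    rewrite Cmod_R, Rabs_right; try lra;
    apply Rle_ge; now apply Rmult_le_pos.
Qed.

(** Here [k] stands for [B2], and [|u2|, |v2| <= 1 - |a2|^2 / b^2]. *)
Lemma coefficient_bounds (a2 a3 u2 v2 : C) (b k D : R) :
  0 < b -> D = Rabs (b ^ 2 - k) ->
  Cmod u2 * b ^ 2 <= b ^ 2 - Cmod a2 ^ 2 ->
  Cmod v2 * b ^ 2 <= b ^ 2 - Cmod a2 ^ 2 ->
  (RtoC (2 * b ^ 2) * a3 = RtoC (b ^ 2 + k) * (a2 * a2) + RtoC (b ^ 3) * u2)%C ->
  (RtoC (2 * b ^ 2) * a3 = RtoC (3 * b ^ 2 - k) * (a2 * a2) - RtoC (b ^ 3) * v2)%C ->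
  Cmod a2 <= b * sqrt b / sqrt (D + b) /\
  Cmod a3 <= Rmax (b ^ 3 / (D + b)) (b / 2).
Proof.
  intros Hb HD Hu Hv E1 E2.
  assert (Pb : 0 < b ^ 2) by (apply pow_lt; assumption).
  set (A := Cmod a2 ^ 2) in *.
  assert (PA : 0 <= A) by apply pow2_ge_0.
  assert (EA : Cmod (a2 * a2)%C = A) by (rewrite Cmod_mult; unfold A; ring).
  set (rho := (b ^ 2 - A) / b ^ 2).
  assert (Erho : b ^ 2 * rho = b ^ 2 - A) by (unfold rho; field; lra).
  assert (Hu' : Cmod u2 <= rho).
  { apply (Rmult_le_reg_l (b ^ 2)); lra. }
  assert (Hv' : Cmod v2 <= rho).
  { apply (Rmult_le_reg_l (b ^ 2)); lra. }
  assert (Hmv' : Cmod (- v2)%C <= rho) by (now rewrite Cmod_opp).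
  assert (D0 : 0 <= D) by (rewrite HD; apply Rabs_pos).
  assert (C3 : 0 <= Cmod a3) by apply Cmod_ge_0.
  assert (E3 : b ^ 3 * rho = b * (b ^ 2 - A)) by (rewrite <- Erho; ring).
  assert (B3 : 0 < b ^ 3) by (apply pow_lt; assumption).
  (* Used with the equation whose coefficient of [a2^2] is the smaller one. *)
  assert (Hs : forall (m : R) (w : C), 0 <= m -> Cmod w <= rho ->
     (RtoC (2 * b ^ 2) * a3 = RtoC m * (a2 * a2) + RtoC (b ^ 3) * w)%C ->
     2 * b ^ 2 * Cmod a3 <= m * A + b * (b ^ 2 - A)).
  { intros m w Hm Hw E.
    replace (2 * b ^ 2 * Cmod a3) with (Cmod (RtoC (2 * b ^ 2) * a3)%C)
      by (rewrite Cmod_mult, Cmod_R, Rabs_right; lra).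
    rewrite E, <- E3. apply Cmod_triangle_le.
    - rewrite Cmod_mult, EA, Cmod_R, Rabs_right by lra. lra.
    - apply Cmod_mult_le; [|assumption]. rewrite Cmod_R, Rabs_right; lra. }
  assert (E2' : (RtoC (2 * b ^ 2) * a3
      = RtoC (3 * b ^ 2 - k) * (a2 * a2) + RtoC (b ^ 3) * (- v2))%C)
    by (rewrite E2; ring).
  (* When the two coefficients of [a2^2] have opposite signs, [a2] is eliminated
     with nonnegative weights. *)
  assert (Hc : forall (p q : R) (X u v : C), 0 <= p -> 0 <= q -> 0 < p + q ->
     Cmod u <= rho -> Cmod v <= rho ->
     (X = RtoC (- q) * (a2 * a2) + RtoC (b ^ 3) * u)%C ->
     (X = RtoC p * (a2 * a2) + RtoC (b ^ 3) * v)%C ->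
     Cmod X <= b * (b ^ 2 - A)).
  { intros p q X u v Hp Hq Hpq Hu1 Hv1 X1 X2.
    apply (Rmult_le_reg_r (p + q)); [assumption|].
    replace (Cmod X * (p + q)) with (Cmod (RtoC p * X + RtoC q * X)%C).
    2:{ replace (RtoC p * X + RtoC q * X)%C with (RtoC (p + q) * X)%C
          by (rewrite RtoC_plus; ring).
        rewrite Cmod_mult, Cmod_R, Rabs_right by lra. ring. }
    rewrite X1 at 1. rewrite X2.
    replace (RtoC p * (RtoC (- q) * (a2 * a2) + RtoC (b ^ 3) * u)
             + RtoC q * (RtoC p * (a2 * a2) + RtoC (b ^ 3) * v))%C
      with (RtoC (b ^ 3 * p) * u + RtoC (b ^ 3 * q) * v)%C
      by (rewrite !RtoC_mult, RtoC_opp; ring).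
    eapply Rle_trans; [apply (Cmod_combination_le p q (b ^ 3) rho); lra|].
    rewrite <- E3. right. ring. }
  assert (HX : 2 * b ^ 2 * Cmod a3 = Cmod (RtoC (2 * b ^ 2) * a3)%C)
    by (rewrite Cmod_mult, Cmod_R, Rabs_right; lra).
  apply bounds_of_linear_bounds; try assumption; try apply Cmod_ge_0.
  - fold A.
    assert (E : (RtoC (2 * (b ^ 2 - k)) * (a2 * a2)
                 = RtoC (b ^ 3 * 1) * u2 + RtoC (b ^ 3 * 1) * v2)%C).
    { replace (RtoC (2 * (b ^ 2 - k)) * (a2 * a2))%C
        with (RtoC (3 * b ^ 2 - k) * (a2 * a2) - RtoC (b ^ 3) * v2
              - RtoC (b ^ 2 + k) * (a2 * a2) + RtoC (b ^ 3) * v2)%C.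
      - rewrite <- E2, E1, !Rmult_1_r. ring.
      - rewrite !RtoC_minus, !RtoC_mult, !RtoC_minus, !RtoC_plus. ring. }
    pose proof (Cmod_combination_le 1 1 (b ^ 3) rho u2 v2) as T.
    rewrite <- E, Cmod_mult, EA, Cmod_R, Rabs_mult, <- HD, Rabs_right in T by lra.
    specialize (T Hu' Hv' ltac:(lra) ltac:(lra) ltac:(lra)). lra.
  - fold A. destruct (Rle_lt_dec k (b ^ 2)) as [L|G].
    + rewrite Rabs_right in HD by lra.
      destruct (Rle_lt_dec 0 (b ^ 2 + k)) as [P|P].
      * rewrite Rmax_right by lra.
        replace (2 * b ^ 2 - D) with (b ^ 2 + k) by lra. now apply (Hs _ u2).
      * rewrite Rmax_left, Rmult_0_l, Rplus_0_l, HX by lra.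
        apply (Hc (3 * b ^ 2 - k) (- (b ^ 2 + k)) _ u2 (- v2)%C); try lra; try assumption.
        rewrite Ropp_involutive. assumption.
    + rewrite Rabs_left in HD by lra.
      destruct (Rle_lt_dec 0 (3 * b ^ 2 - k)) as [P|P].
      * rewrite Rmax_right by lra.
        replace (2 * b ^ 2 - D) with (3 * b ^ 2 - k) by lra. now apply (Hs _ (- v2)%C).
      * rewrite Rmax_left, Rmult_0_l, Rplus_0_l, HX by lra.
        apply (Hc (b ^ 2 + k) (- (3 * b ^ 2 - k)) _ (- v2)%C u2); try lra; try assumption.
        rewrite Ropp_involutive. assumption.
Qed.

Theorem theorem1p5 :
  forall (phi : C -> C) (B : nat -> C) (f : C -> C) (a : nat -> C),
    analytic_in_disk phi ->
    has_expansion phi B ->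
    B 0%nat = RtoC 1 ->
    (forall z : C, in_disk z -> 0 < Re (phi z)) ->
    phi (RtoC 0) = RtoC 1 ->
    B 1%nat = C_derive phi (RtoC 0) ->
    Im (B 1%nat) = 0 ->
    0 < Re (B 1%nat) ->
    symmetric_about_real_axis (disk_image phi) ->
    starlike_wrt (RtoC 1) (disk_image phi) ->
    Im (C_derive (C_derive phi) (RtoC 0)) = 0 ->
    normalized_expansion f a ->
    bi_starlike phi f ->
    let B1 := Re (B 1%nat) in
    let B2 := Re (B 2%nat) in
    (B2 <= B1 ^ 2 ->
       Cmod (a 2%nat) <= B1 * sqrt B1 / sqrt (B1 ^ 2 + B1 - B2) /\
       Cmod (a 3%nat) <= Rmax (B1 ^ 3 / (B1 ^ 2 - B2 + B1)) (B1 / 2))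
    /\
    (B1 ^ 2 <= B2 ->
       Cmod (a 2%nat) <= B1 * sqrt B1 / sqrt (B2 + B1 - B1 ^ 2) /\
       Cmod (a 3%nat) <= Rmax (B1 ^ 3 / (B2 + B1 - B1 ^ 2)) (B1 / 2)).
Proof.
  intros phi B f a Hphi HB B0 _ _ _ ImB1 PB1 _ _ ImB2 (a0 & a1 & Hf) HS B1 B2.
  destruct HS as ((_ & Uf & _) & g & (Ug & GF) & Sf & Sg).
  pose proof (has_expansion_local _ _ HB) as EB.
  pose proof (has_expansion_local _ _ Hf) as Ef.
  assert (D0 : in_disk 0) by (unfold in_disk; rewrite Cmod_0; lra).
  destruct (analytic_local_expansion g 0 (proj1 Ug) D0) as (b & s & Eg).
  destruct (inverse_coefficients f g a b 1 s (1 / 4) Ef a0 a1 Eg) as (b0 & b1 & b2 & b3);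
    [lra|exact GF|].
  destruct (starlike_coefficients phi f B a 1 1 EB B0 Uf Ef a0 a1 Sf)
    as (u1 & u2 & Hu & A2 & A3).
  destruct (starlike_coefficients phi g B b s 1 EB B0 Ug Eg b0 b1 Sg)
    as (v1 & v2 & Hv & C2 & C3).
  rewrite b2 in C2, C3. rewrite b3 in C3.
  rewrite (jet_derive _ _ _ _ _ (derive_jet phi B 1 Hphi EB)) in ImB2.
  assert (R1 : B 1%nat = RtoC B1)
    by (apply injective_projections; [reflexivity|exact ImB1]).
  assert (R2 : B 2%nat = RtoC B2).
  { apply injective_projections; [reflexivity|].
    unfold Im in ImB2. simpl in ImB2. simpl. lra. }
  rewrite R1 in A2, A3, C2, C3. rewrite R2 in A3, C3.
  change (0 < B1) in PB1.
  assert (N1 : RtoC B1 <> 0%C) by (intro Z; injection Z; lra).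
  assert (P2 : 0 < B1 ^ 2) by (apply pow_lt; assumption).
  assert (M1 : Cmod (a 2%nat) ^ 2 = B1 ^ 2 * Cmod u1 ^ 2).
  { rewrite A2, Cmod_mult, Cmod_R, Rpow_mult_distr, pow2_abs. reflexivity. }
  assert (M2 : Cmod (a 2%nat) ^ 2 = B1 ^ 2 * Cmod v1 ^ 2).
  { rewrite <- Cmod_opp, C2, Cmod_mult, Cmod_R, Rpow_mult_distr, pow2_abs. reflexivity. }
  assert (Q1 : (RtoC B1 * RtoC B1 * (u1 * u1) = a 2%nat * a 2%nat)%C)
    by (rewrite A2; ring).
  assert (Q2 : (RtoC B1 * RtoC B1 * (v1 * v1) = a 2%nat * a 2%nat)%C).
  { transitivity ((- a 2%nat) * (- a 2%nat))%C; [rewrite C2|]; ring. }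
  destruct (coefficient_bounds (a 2%nat) (a 3%nat) u2 v2 B1 B2 (Rabs (B1 ^ 2 - B2)) PB1 eq_refl)
    as [X2 X3].
  - rewrite M1. nra.
  - rewrite M2. nra.
  - transitivity (RtoC B1 * RtoC B1 * (2 * a 3%nat))%C.
    { rewrite RtoC_mult, RtoC_pow. simpl. ring. }
    rewrite A3.
    transitivity (RtoC B1 * RtoC B1 * (a 2%nat * a 2%nat + RtoC B1 * u2)
                  + RtoC B2 * (RtoC B1 * RtoC B1 * (u1 * u1)))%C; [ring|].
    rewrite Q1, RtoC_plus, !RtoC_pow. simpl. ring.
  - assert (E : (2 * a 3%nat = 3 * (a 2%nat * a 2%nat) - RtoC B1 * v2 - RtoC B2 * (v1 * v1))%C).
    { transitivity (4 * (a 2%nat * a 2%nat) - 2 * (2 * (a 2%nat * a 2%nat) - a 3%nat))%C;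
        [ring|]. rewrite C3. ring. }
    transitivity (RtoC B1 * RtoC B1 * (2 * a 3%nat))%C.
    { rewrite RtoC_mult, RtoC_pow. simpl. ring. }
    rewrite E.
    transitivity (RtoC B1 * RtoC B1 * (3 * (a 2%nat * a 2%nat) - RtoC B1 * v2)
                  - RtoC B2 * (RtoC B1 * RtoC B1 * (v1 * v1)))%C; [ring|].
    rewrite Q2, RtoC_minus, RtoC_mult, !RtoC_pow. simpl. ring.
  - split; intro L.
    + rewrite Rabs_right in X2, X3 by lra.
      replace (B1 ^ 2 + B1 - B2) with (B1 ^ 2 - B2 + B1) by ring. now split.
    + replace (B2 + B1 - B1 ^ 2) with (Rabs (B1 ^ 2 - B2) + B1)
        by (rewrite Rabs_left1; lra).
      now split.
Qed.
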